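(* Let $f:\mathbb{R}^n\to\mathbb{R}$ be a strongly convex function with Lipschitz continuous gradient $\nabla f$, let $A\in\mathbb{R}^{d\times n}$ be a matrix with full row rank and rows $a_1^T,\dots,a_d^T$, and let $b\in\mathbb{R}^d$. For $\mu>0$ let $$\mathcal{G}_\mu(x;y)=f(x)+\sum_{i=1}^d h_\mu(a_i^Tx-b_i,\,y_i),\qquad x\in\mathbb{R}^n,\ y\in\mathbb{R}^d,$$ be the generalized Lagrangian associated with the problem of minimizing $f(x)$ subject to $Ax-b\le 0$, where $$h_\mu(v,w)=\begin{cases}vw+\mu v^2/2, & \mu v+w\ge 0,\\ -w^2/(2\mu), & \mu v+w\le 0.\end{cases}$$ With $z=(x,y)\in\mathbb{R}^{n+d}$ and $\mathrm{e}_i$ the $i$th canonical basis vector of $\mathbb{R}^d$, let $$F(z)=\begin{bmatrix}-\nabla_x\mathcal{G}_\mu(x;y)\\ \nabla_y\mathcal{G}_\mu(x;y)\end{bmatrix}=\begin{bmatrix}-\nabla f(x)-\sum_{i=1}^d\max\big(\mu(a_i^Tx-b_i)+y_i,\,0\big)\,a_i\\ \frac1\mu\sum_{i=1}^d\max\big(\mu(a_i^Tx-b_i),\,-y_i\big)\,\mathrm{e}_i\end{bmatrix}.$$ Then, for any $\mu>0$ and any $\eta_1,\eta_2,\lambda_2>0$, $\lambda_1\in(0,1)$, the unique saddle point of $\mathcal{G}_\mu$ is a globally fixed-time stable equilibrium point of $$\dot z=\sigma(z)F(z),\qquad \sigma(z)=\begin{cases}0, & F(z)=0,\\ \eta_1\|F(z)\|^{-\lambda_1}+\eta_2\|F(z)\|^{\lambda_2},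 & \text{otherwise.}\end{cases}$$
   Context: $\|\cdot\|$ is the Euclidean norm; the inequality $Ax-b\le 0$ is componentwise. Saddle point: $(x^\star,y^\star)$ is a saddle point of $\mathcal{G}_\mu$ if $\mathcal{G}_\mu(x^\star;y)\le\mathcal{G}_\mu(x^\star;y^\star)\le\mathcal{G}_\mu(x;y^\star)$ for all $x\in\mathbb{R}^n$, $y\in\mathbb{R}^d$. The function $\mathcal{G}_\mu$ is continuously differentiable, convex in $x$ and concave in $y$. Global finite-time stability: an equilibrium point $z^\star$ of a system $\dot z=G(z)$ is globally finite-time stable if (i) it is stable in the sense of Lyapunov, and (ii) there is a settling-time function $\tau:\mathbb{R}^{n+d}\to[0,\infty)$ such that the solution starting from $z(0)$ satisfies $\lim_{t\to\tau(z(0))}z(t)=z^\star$; here $\tau(z(0))$ is the first time at which the solution reaches $z^\star$. Global fixed-time stability: $z^\star$ is globally fixed-time stable if it is globally finite-time stable and $\sup_{z}\tau(z)<\infty$. *)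

(* Defs.v *)
From HB Require Import structures.
From mathcomp Require Import all_boot all_order all_algebra.
From mathcomp Require Import all_classical all_reals all_analysis.

Set Implicit Arguments.
Unset Strict Implicit.
Unset Printing Implicit Defensive.

Import Order.TTheory GRing.Theory Num.Theory.
Import numFieldNormedType.Exports.

Local Open Scope classical_set_scope.
Local Open Scope ring_scope.

(* The library norm `|x| on matrices is the sup norm, so the Euclidean norm is
   introduced separately; both induce the same topology. *)
Definition enorm (R : realType) (n : nat) (x : 'cV[R]_n) : R :=
  Num.sqrt (\sum_(i < n) x i 0 ^+ 2).

Definition gradient (R : realType) (n : nat) (f : 'cV[R]_n -> R)
    (x : 'cV[R]_n) : 'cV[R]_n :=
  \col_i 'D_(delta_mx i 0) f x.

Definition strongly_convex (R : realType) (n : nat) (f : 'cV[R]_n -> R) : Prop :=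
  exists2 m : R, 0 < m &
    forall (x y : 'cV[R]_n) (t : R), 0 <= t <= 1 ->
      f (t *: x + (1 - t) *: y) <=
        t * f x + (1 - t) * f y - m / 2 * t * (1 - t) * enorm (x - y) ^+ 2.

Definition lipschitz_gradient (R : realType) (n : nat) (f : 'cV[R]_n -> R) : Prop :=
  (forall x, differentiable f x) /\
  exists L : R, forall x y : 'cV[R]_n,
    enorm (gradient f x - gradient f y) <= L * enorm (x - y).

Definition residual (R : realType) (n d : nat) (A : 'M[R]_(d, n)) (b : 'cV[R]_d)
    (x : 'cV[R]_n) (i : 'I_d) : R :=
  (row i A *m x) 0 0 - b i 0.

Definition hmu (R : realType) (mu v w : R) : R :=
  if 0 <= mu * v + w then v * w + mu * v ^+ 2 / 2 else - (w ^+ 2 / (2 * mu)).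

Definition gen_lagrangian (R : realType) (n d : nat) (f : 'cV[R]_n -> R)
    (A : 'M[R]_(d, n)) (b : 'cV[R]_d) (mu : R)
    (x : 'cV[R]_n) (y : 'cV[R]_d) : R :=
  f x + \sum_(i < d) hmu mu (residual A b x i) (y i 0).

Definition saddle_point (R : realType) (n d : nat)
    (L : 'cV[R]_n -> 'cV[R]_d -> R) (z : 'cV[R]_(n + d)) : Prop :=
  forall (x : 'cV[R]_n) (y : 'cV[R]_d),
    L (usubmx z) y <= L (usubmx z) (dsubmx z) /\
    L (usubmx z) (dsubmx z) <= L x (dsubmx z).

Definition saddle_field (R : realType) (n d : nat)
    (L : 'cV[R]_n -> 'cV[R]_d -> R) (z : 'cV[R]_(n + d)) : 'cV[R]_(n + d) :=
  col_mx (- gradient (fun x => L x (dsubmx z)) (usubmx z))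
         (gradient (fun y => L (usubmx z) y) (dsubmx z)).

Definition time_scaling (R : realType) (m : nat) (F : 'cV[R]_m -> 'cV[R]_m)
    (eta1 eta2 lambda1 lambda2 : R) (z : 'cV[R]_m) : R :=
  if F z == 0 then 0
  else eta1 * enorm (F z) `^ (- lambda1) + eta2 * enorm (F z) `^ lambda2.

(* Forward solutions on [0, +oo). For continuous G, the one-sided derivative at
   time 0 then automatically exists and equals G z0. *)
Definition solution (R : realType) (m : nat) (G : 'cV[R]_m -> 'cV[R]_m)
    (z0 : 'cV[R]_m) (z : R -> 'cV[R]_m) : Prop :=
  [/\ z 0 = z0,
      {within `[0, +oo[, continuous z} &
      forall t : R, 0 < t -> is_derive t 1 z (G (z t))].

Definition equilibrium (R : realType) (m : nat) (G : 'cV[R]_m -> 'cV[R]_m)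
    (zs : 'cV[R]_m) : Prop :=
  G zs = 0.

Definition lyapunov_stable (R : realType) (m : nat) (G : 'cV[R]_m -> 'cV[R]_m)
    (zs : 'cV[R]_m) : Prop :=
  forall e : R, 0 < e -> exists2 delta : R, 0 < delta &
    forall (z0 : 'cV[R]_m) (z : R -> 'cV[R]_m), solution G z0 z ->
      enorm (z0 - zs) < delta -> forall t : R, 0 <= t -> enorm (z t - zs) < e.

(* "The" solution starting from z0 is read as: it exists on [0, +oo) and is
   unique there. The limit at tau z0 is taken within [0, +oo), so that it also
   makes sense when tau z0 = 0. *)
Definition settling_time (R : realType) (m : nat) (G : 'cV[R]_m -> 'cV[R]_m)
    (zs : 'cV[R]_m) (tau : 'cV[R]_m -> R) : Prop :=
  forall z0 : 'cV[R]_m, 0 <= tau z0 /\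
    exists z : R -> 'cV[R]_m,
      [/\ solution G z0 z,
          forall w, solution G z0 w -> forall t : R, 0 <= t -> w t = z t,
          z t @[t --> within `[0, +oo[ (nbhs (tau z0))] --> zs,
          z (tau z0) = zs &
          forall t : R, 0 <= t < tau z0 -> z t <> zs].

Definition globally_finite_time_stable (R : realType) (m : nat)
    (G : 'cV[R]_m -> 'cV[R]_m) (zs : 'cV[R]_m) : Prop :=
  lyapunov_stable G zs /\ exists tau, settling_time G zs tau.

Definition globally_fixed_time_stable (R : realType) (m : nat)
    (G : 'cV[R]_m -> 'cV[R]_m) (zs : 'cV[R]_m) : Prop :=
  globally_finite_time_stable G zs /\
  exists2 tau, settling_time G zs tau & has_ubound (range tau).

(* Main.v *)
Require Import Defs.
From HB Require Import structures.
From mathcomp Require Import all_boot all_order all_algebra.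
From mathcomp Require Import all_classical all_reals all_analysis.
From mathcomp Require Import ring lra.

Set Implicit Arguments.
Unset Strict Implicit.
Unset Printing Implicit Defensive.

Import Order.TTheory GRing.Theory Num.Theory.
Import numFieldNormedType.Exports.

Local Open Scope classical_set_scope.
Local Open Scope ring_scope.

(* In the metric of P = [[a I, A^T], [A, a I]] with a large, the field -F is
   strongly monotone: strong convexity damps x, the multiplier
   p = max(mu (A x - b) + y, 0) damps y up to the error p - y, and the
   off-diagonal blocks of P contribute -|A^T y|^2, which dominates |y|^2 because A
   has full row rank. As F is also Lipschitz, it has exactly one zero, which is
   the saddle point since G_mu is convex in x and concave in y.

   The energy E = |z - zs|_P^2 then satisfies along z' = sigma(z) F(z)
     E' <= - k1 E^(1 - l1/2) - k2 E^(1 + l2/2),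
   so E vanishes after a time that does not depend on z(0). The field sigma F is
   continuous but not Lipschitz at zs: existence is Peano's theorem, and
   uniqueness is Gronwall's inequality away from zs together with the
   monotonicity of E at zs. *)

(** * Euclidean inner product *)

(** Three demands fix [a]: positivity of [P], absorption of the primal cross terms by strong
    convexity, and absorption of the error [p - y]; [a] is a sum of three numbers, one for each. The
    zero of [F] comes from an explicit Euler iteration that contracts |F|_P^2 geometrically. Strong
    monotonicity bounds |z - w| by a multiple of |F z - F w|, so the iterates stay bounded and have
    a limit point, at which [F] vanishes. The exponents of E arise because |F|^2 is comparable to E:
    the Lipschitz bound gives one side, strong monotonicity the other. The obstacle is regularity.
    The factor sigma blows up at zs, and only l1 < 1 keeps sigma F continuous there. Peano's theorem
    is available for bounded fields, hence a cutoff in terms of the energy. For Gronwall, |F| stays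
    away from 0 on a shell v <= E <= M with v > 0, where sigma is Lipschitz as a function of |F|;
    the remaining part of the difference has the good sign by monotonicity. Limits are taken along
    an ultrafilter, for Peano as for the zero, in place of subsequences. *)

Definition dot {R : realType} {n : nat} (u v : 'cV[R]_n) : R := (u^T *m v) 0 0.

Section dot_product.
Context {R : realType}.
Implicit Types (n p : nat).

Lemma dotE n (u v : 'cV[R]_n) : dot u v = \sum_i u i 0 * v i 0.
Proof. by rewrite /dot mxE; apply: eq_bigr => i _; rewrite mxE. Qed.

Lemma dotC n (u v : 'cV[R]_n) : dot u v = dot v u.
Proof. by rewrite !dotE; apply: eq_bigr => i _; rewrite mulrC. Qed.

Lemma dotDr n (u v w : 'cV[R]_n) : dot u (v + w) = dot u v + dot u w.
Proof. by rewrite /dot mulmxDr mxE. Qed.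

Lemma dotZr n a (u v : 'cV[R]_n) : dot u (a *: v) = a * dot u v.
Proof. by rewrite /dot -scalemxAr mxE. Qed.

Lemma dotNr n (u v : 'cV[R]_n) : dot u (- v) = - dot u v.
Proof. by rewrite -scaleN1r dotZr mulN1r. Qed.

Lemma dotDl n (u v w : 'cV[R]_n) : dot (u + v) w = dot u w + dot v w.
Proof. by rewrite dotC dotDr !(dotC w). Qed.

Lemma dotZl n a (u v : 'cV[R]_n) : dot (a *: u) v = a * dot u v.
Proof. by rewrite dotC dotZr dotC. Qed.

Lemma dotNl n (u v : 'cV[R]_n) : dot (- u) v = - dot u v.
Proof. by rewrite dotC dotNr dotC. Qed.

Lemma dot0r n (u : 'cV[R]_n) : dot u 0 = 0.
Proof. by rewrite /dot mulmx0 mxE. Qed.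

Lemma dot0l n (u : 'cV[R]_n) : dot 0 u = 0.
Proof. by rewrite dotC dot0r. Qed.

Lemma dot_mulmx n p (A : 'M[R]_(p, n)) u v : dot u (A *m v) = dot (A^T *m u) v.
Proof. by rewrite /dot trmx_mul trmxK mulmxA. Qed.

Lemma dot_col_mx n p (x x' : 'cV[R]_n) (y y' : 'cV[R]_p) :
  dot (col_mx x y) (col_mx x' y') = dot x x' + dot y y'.
Proof. by rewrite /dot tr_col_mx mul_row_col mxE. Qed.

Lemma dot_ge0 n (u : 'cV[R]_n) : 0 <= dot u u.
Proof. by rewrite dotE; apply: sumr_ge0 => i _; rewrite -expr2 sqr_ge0. Qed.

Lemma sqr_coord_le_dot n (u : 'cV[R]_n) i : u i 0 ^+ 2 <= dot u u.
Proof.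
rewrite dotE (bigD1 i) //= -expr2 lerDl.
by apply: sumr_ge0 => j _; rewrite -expr2 sqr_ge0.
Qed.

Lemma dot_eq0 n (u : 'cV[R]_n) : (dot u u == 0) = (u == 0).
Proof.
apply/eqP/eqP => [u0|->]; last by rewrite dot0r.
apply/colP => i; rewrite mxE; apply/eqP; rewrite -sqrf_eq0 eq_le sqr_ge0 andbT.
by rewrite -u0 sqr_coord_le_dot.
Qed.

Lemma dot_gt0 n (u : 'cV[R]_n) : (0 < dot u u) = (u != 0).
Proof. by rewrite lt_def dot_ge0 andbT dot_eq0. Qed.

Lemma sqr_enorm n (u : 'cV[R]_n) : enorm u ^+ 2 = dot u u.
Proof.
rewrite /enorm sqr_sqrtr; last by apply: sumr_ge0 => i _; rewrite sqr_ge0.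
by rewrite dotE; apply: eq_bigr => i _; rewrite expr2.
Qed.

Lemma enorm_ge0 n (u : 'cV[R]_n) : 0 <= enorm u.
Proof. exact: sqrtr_ge0. Qed.

Lemma enormE n (u : 'cV[R]_n) : enorm u = Num.sqrt (dot u u).
Proof. by rewrite -sqr_enorm sqrtr_sqr ger0_norm // enorm_ge0. Qed.

Lemma enorm_eq0 n (u : 'cV[R]_n) : (enorm u == 0) = (u == 0).
Proof. by rewrite -sqrf_eq0 sqr_enorm dot_eq0. Qed.

Lemma dot_AMGM n k (u v : 'cV[R]_n) : 0 < k ->
  2 * dot u v <= k * dot u u + k^-1 * dot v v.
Proof.
move=> k0; have := dot_ge0 (k *: u - v).
rewrite dotDl !dotDr !dotNl !dotNr !dotZl !dotZr (dotC v u) => h.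
rewrite -(ler_pM2l k0) mulrDr mulrA (mulrA k k^-1) divff ?gt_eqF // mul1r.
rewrite mulrCA; lra.
Qed.

Lemma dot_CauchySchwarz n (u v : 'cV[R]_n) :
  dot u v ^+ 2 <= dot u u * dot v v.
Proof.
have [->|v0] := eqVneq v 0; first by rewrite !dot0r mulr0 expr0n.
rewrite -dot_gt0 in v0.
(* This vector is |v|^2 times the component of [u] orthogonal to [v]; its squared norm is |v|^2
   (|u|^2 |v|^2 - (u.v)^2). *)
have := dot_ge0 (dot v v *: u - dot u v *: v).
rewrite dotDl !dotDr !dotNl !dotNr !dotZl !dotZr (dotC v u) => h.
by rewrite -(ler_pM2l v0) -subr_ge0; move: h; congr (_ <= _); ring.
Qed.

Lemma mulmx_dot_bounded n p (A : 'M[R]_(p, n)) : exists2 C, 0 < C &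
  forall x, dot (A *m x) (A *m x) <= C * dot x x.
Proof.
(* The squared Frobenius norm suffices, by Cauchy-Schwarz on each row; the 1 keeps the constant
   positive when [A] is zero. *)
exists (1 + \sum_i dot (row i A)^T (row i A)^T).
  by apply: ltr_pwDl => //; apply: sumr_ge0 => i _; exact: dot_ge0.
move=> x; apply: (@le_trans _ _ ((\sum_i dot (row i A)^T (row i A)^T) * dot x x)).
  rewrite dotE mulr_suml; apply: ler_sum => i _.
  rewrite -expr2; have := dot_CauchySchwarz (row i A)^T x; congr (_ ^+ 2 <= _).
  rewrite dotE mxE; apply: eq_bigr => j _; by rewrite !mxE.
by rewrite ler_wpM2r ?dot_ge0 // lerDr.
Qed.

Lemma sqr_mx_norm_le_dot n (u : 'cV[R]_n) : `|u| ^+ 2 <= dot u u.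
Proof.
have -> : `|u| = mx_norm u by [].
have [->|/mx_norm_neq0[[i j] ->]] := eqVneq (mx_norm u) 0.
  by rewrite expr0n dot_ge0.
by rewrite (ord1 j) real_normK ?num_real // sqr_coord_le_dot.
Qed.

Lemma coord_le_mx_norm n (u : 'cV[R]_n) i : `|u i 0| <= `|u|.
Proof.
have -> : `|u| = mx_norm u by [].
rewrite mx_normrE.
by apply/bigmax_geP; right => /=; exists (i, 0).
Qed.

Lemma dot_le_sqr_mx_norm n (u : 'cV[R]_n) : dot u u <= n%:R * `|u| ^+ 2.
Proof.
rewrite dotE; have -> : n%:R * `|u| ^+ 2 = \sum_(i < n) `|u| ^+ 2.
  by rewrite sumr_const card_ord mulr_natl.
apply: ler_sum => i _; rewrite -expr2 -real_normK ?num_real //.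
by rewrite ler_sqr ?nnegrE ?normr_ge0 // coord_le_mx_norm.
Qed.

End dot_product.

(** * Euclidean norm against the library norm, and continuity *)

Section euclidean_norm.
Context {R : realType}.

Lemma normr_dot_le n (u v : 'cV[R]_n) : `|dot u v| <= enorm u * enorm v.
Proof.
rewrite -(@ler_pXn2r _ 2) ?nnegrE ?mulr_ge0 ?enorm_ge0 //.
by rewrite real_normK ?num_real // exprMn !sqr_enorm dot_CauchySchwarz.
Qed.

Lemma enormD n (u v : 'cV[R]_n) : enorm (u + v) <= enorm u + enorm v.
Proof.
rewrite -(@ler_pXn2r _ 2) ?nnegrE ?addr_ge0 ?enorm_ge0 //.
rewrite sqrrD !sqr_enorm dotDl !dotDr (dotC v u).
by have := le_trans (ler_norm _) (normr_dot_le u v); lra.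
Qed.

Lemma enormN n (u : 'cV[R]_n) : enorm (- u) = enorm u.
Proof. by rewrite !enormE dotNl dotNr opprK. Qed.

Lemma enormZ n a (u : 'cV[R]_n) : enorm (a *: u) = `|a| * enorm u.
Proof. by rewrite !enormE dotZl dotZr mulrA sqrtrM ?sqr_ge0 // sqrtr_sqr. Qed.

Lemma enorm_dist n (u v : 'cV[R]_n) : `|enorm u - enorm v| <= enorm (u - v).
Proof.
have h (a b : 'cV[R]_n) : enorm a - enorm b <= enorm (a - b).
  by rewrite lerBlDr; have := enormD (a - b) b; rewrite subrK.
by rewrite ler_norml h andbT lerNl opprB -[leRHS]enormN opprB h.
Qed.

Lemma mx_norm_le_enorm n (u : 'cV[R]_n) : `|u| <= enorm u.
Proof.
by rewrite -(@ler_pXn2r _ 2) ?nnegrE ?enorm_ge0 // sqr_enorm sqr_mx_norm_le_dot.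
Qed.

Lemma enorm_le_mx_norm n (u : 'cV[R]_n) : enorm u <= Num.sqrt n%:R * `|u|.
Proof.
rewrite -(@ler_pXn2r _ 2) ?nnegrE ?mulr_ge0 ?sqrtr_ge0 ?enorm_ge0 //.
by rewrite sqr_enorm exprMn sqr_sqrtr // dot_le_sqr_mx_norm.
Qed.

Lemma enorm_le_sqrt n p (u : 'cV[R]_n) (v : 'cV[R]_p) k : 0 <= k ->
  dot u u <= k * dot v v -> enorm u <= Num.sqrt k * enorm v.
Proof. by move=> k0 h; rewrite !enormE -sqrtrM // ler_wsqrtr. Qed.

Lemma lipschitz_continuous (V W : normedModType R) (f : V -> W) (k : R) :
  (forall x y, `|f x - f y| <= k * `|x - y|) -> continuous f.
Proof.
move=> fk x; apply/cvgrPdist_le => e e0.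
have k0 : 0 < `|k| + 1 by rewrite ltr_wpDl.
near=> y; apply: (le_trans (fk x y)).
apply: (@le_trans _ _ ((`|k| + 1) * `|x - y|)).
  by rewrite ler_wpM2r // (le_trans (ler_norm k)) // lerDl.
rewrite -ler_pdivlMl // mulrC ltW //; near: y.
by apply: (@cvgr_dist_lt _ _ _ (nbhs x) _ id); [exact: cvg_id|rewrite divr_gt0].
Unshelve. all: by end_near. Qed.

(** Meant for the scaled field at a zero of [F]: the scaling factor has no continuous extension
    there, but the size of the product is controlled by the norm of [F]. *)
Lemma continuous_at_zero (V W : normedModType R) (f : V -> W) (g : V -> R) x :
  f x = 0 -> {for x, continuous g} -> g x = 0 ->
  (forall e, 0 < e -> exists2 del, 0 < del &
     forall y, `|g y| < del -> `|f y| <= e) ->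
  {for x, continuous f}.
Proof.
move=> fx0 gc gx0 fg; apply/cvgrPdist_le => e /fg[del del0 {}fg].
have gdel := @cvgr_dist_lt _ _ _ (nbhs x) _ _ _ gc _ del0.
near=> y; rewrite fx0 sub0r normrN; apply: fg.
by rewrite -normrN -sub0r -gx0; near: y; exact: gdel.
Unshelve. all: by end_near. Qed.

Lemma enorm_continuous n : continuous (@enorm R n).
Proof.
apply: (@lipschitz_continuous _ _ _ (Num.sqrt n%:R)) => x y.
exact: le_trans (enorm_dist x y) (enorm_le_mx_norm _).
Qed.

Lemma enorm_lipschitz_continuous n p (f : 'cV[R]_n -> 'cV[R]_p) k : 0 <= k ->
  (forall x y, enorm (f x - f y) <= k * enorm (x - y)) -> continuous f.
Proof.
move=> k0 fk; apply: (@lipschitz_continuous _ _ _ (k * Num.sqrt n%:R)) => x y.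
apply: (le_trans (mx_norm_le_enorm _)); apply: (le_trans (fk x y)).
by rewrite -mulrA ler_wpM2l // enorm_le_mx_norm.
Qed.

Lemma cvg_dot (T : Type) (U : set_system T) n (u v : T -> 'cV[R]_n) (a b : 'cV[R]_n) :
  Filter U -> u @ U --> a -> v @ U --> b ->
  (fun x => dot (u x) (v x)) @ U --> dot a b.
Proof.
move=> FU ua vb; rewrite dotE.
have -> : (fun x => dot (u x) (v x)) = (fun x => \sum_i u x i 0 * v x i 0).
  by apply/funext => x; rewrite dotE.
have coord (w : T -> 'cV[R]_n) (c : 'cV[R]_n) i :
    w @ U --> c -> (fun x => w x i 0) @ U --> c i 0.
  move=> wc; exact: (cvg_comp w (fun M : 'cV[R]_n => M i 0) wc
    (@coord_continuous R n 1 i 0 c)).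
apply: (@cvg_big _ _ +%R 0) => [|i _]; first exact: add_continuous.
by apply: cvgM; exact: coord.
Qed.

Lemma mulmx_continuous n p (P : 'M[R]_(p, n)) :
  continuous (fun u : 'cV[R]_n => P *m u).
Proof.
have [C C0 hC] := mulmx_dot_bounded P.
apply: (@enorm_lipschitz_continuous _ _ _ (Num.sqrt C)); rewrite ?sqrtr_ge0 //.
by move=> x y; rewrite -mulmxBr; exact: enorm_le_sqrt (ltW C0) (hC _).
Qed.

Lemma quad_continuous n (P : 'M[R]_n) :
  continuous (fun u : 'cV[R]_n => dot u (P *m u)).
Proof.
by move=> u; exact: (@cvg_dot _ (nbhs u) _ id (fun v => P *m v) u _ _ cvg_id
  (@mulmx_continuous _ _ P u)).
Qed.

End euclidean_norm.

(** * Peano's existence theorem *)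

(** Compactness gives a cluster point, and an ultrafilter converges to each of its cluster
    points. *)
Lemma ultra_compact_cvg (T : Type) (V : topologicalType) (A : set V)
    (U : set_system T) (x : T -> V) :
  UltraFilter U -> compact A -> (forall k, A (x k)) ->
  exists l : V, x @ U --> l.
Proof.
move=> UU cA xA.
have [|l [Al cl]] := cA (x @ U) _.
  by have : U (x @^-1` A) by apply: filterE => k; exact: xA.
exists l => B nB; have [//|UC] := in_ultra_setVsetC (x @^-1` B) UU.
by have [v []] := cl (~` B) B UC nB.
Qed.

Section peano.
Context {R : realType} {m : nat}.
Implicit Types (x v : 'cV[R]_m).

Lemma ultra_bounded_cvg (T : Type) (U : set_system T) (x : T -> 'cV[R]_m) M :
  UltraFilter U -> (forall k, `|x k| <= M) -> exists l : 'cV[R]_m, x @ U --> l.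
Proof.
move=> UU xM.
have coord i : exists l : R, (fun k => x k i 0) @ U --> l.
  apply: (@ultra_compact_cvg _ _ `[-M, M]) => // [|k].
    exact: segment_compact.
  by rewrite /= in_itv /= -ler_norml (le_trans (coord_le_mx_norm _ _)).
have [l lP] := choice coord.
exists (\col_i l i); apply/cvgrPdist_lt => e e0.
have : \forall k \near U, forall i, `|l i - x k i 0| < e.
  apply: filter_forall => i.
  exact: (@cvgr_dist_lt _ _ _ U _ _ _ (lP i) e e0).
apply: filterS => k ke.
have -> : `|\col_i l i - x k| = mx_norm (\col_i l i - x k) by [].
rewrite mx_normrE; apply/bigmax_ltP; split=> // -[i j] _ /=.
by rewrite (ord1 j) !mxE.
Qed.

Definition euler (G : 'cV[R]_m -> 'cV[R]_m) (h : R) z0 (j : nat) : 'cV[R]_m :=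
  iter j (fun x => x + h *: G x) z0.

(** The increment is [h] times a sum of values of [G], each within [e] of [v]. With [v = 0] this is
    a Lipschitz bound; with [v] the field at the limit point it becomes differentiability. *)
Lemma euler_increment (G : 'cV[R]_m -> 'cV[R]_m) h z0 v e i j : 0 <= h ->
  (i <= j)%N ->
  (forall l, (i <= l < j)%N -> `|G (euler G h z0 l) - v| <= e) ->
  `|euler G h z0 j - euler G h z0 i - (h * j%:R - h * i%:R) *: v|
    <= e * (h * j%:R - h * i%:R).
Proof.
move=> h0; elim: j => [|j IH] ij Ge.
  by move: ij; rewrite leqn0 => /eqP ->; rewrite !subrr scale0r subr0 mulr0 normr0.
move: ij; rewrite leq_eqVlt => /orP[/eqP ->|ij].
  by rewrite !subrr scale0r subr0 mulr0 normr0.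
have {}IH := IH ij (fun l lj => Ge l ltac:(by case/andP: lj => -> /ltnW)).
set E := euler G h z0 in Ge IH *.
have -> : E j.+1 - E i - (h * j.+1%:R - h * i%:R) *: v =
    (E j - E i - (h * j%:R - h * i%:R) *: v) + h *: (G (E j) - v).
  rewrite /E /= -/(E j) -/(euler G h z0 j) -/(E j) scalerBr -natr1 mulrDr mulr1.
  by rewrite !scalerBl scalerDl; apply/colP => k; rewrite !mxE; ring.
apply: (le_trans (ler_normD _ _)).
have -> : e * (h * j.+1%:R - h * i%:R) = e * (h * j%:R - h * i%:R) + h * e.
  by rewrite -natr1; ring.
rewrite lerD // normrZ ger0_norm // ler_wpM2l //.
by apply: Ge; rewrite -ltnS ij /=.
Qed.

Lemma euler_lipschitz (G : 'cV[R]_m -> 'cV[R]_m) h z0 M i j : 0 <= h ->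
  (forall x, `|G x| <= M) ->
  `|euler G h z0 j - euler G h z0 i| <= M * `|h * j%:R - h * i%:R|.
Proof.
move=> h0 GM; wlog ij : i j / (i <= j)%N.
  move=> wl; case: (leqP i j) => [|/ltnW] ij; first exact: wl.
  by rewrite distrC (distrC (h * _)); exact: wl.
have := @euler_increment G h z0 0 M i j h0 ij.
rewrite scaler0 subr0 ger0_norm; last by rewrite subr_ge0 ler_wpM2l // ler_nat.
by apply=> l _; rewrite subr0.
Qed.

(** The last Euler node before [t]. Since it tends to [t], piecewise constant approximations suffice
    and no interpolation is made. *)
Definition grid (k : nat) (t : R) : R := k.+1%:R^-1 * (Num.truncn (k.+1%:R * t))%:R.

Definition euler_step (G : 'cV[R]_m -> 'cV[R]_m) z0 (k : nat) (t : R) :=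
  euler G k.+1%:R^-1 z0 (Num.truncn (k.+1%:R * t)).

Lemma grid_dist k t : 0 <= t -> `|grid k t - t| <= k.+1%:R^-1.
Proof.
move=> t0; have k0 : 0 < k.+1%:R :> R by rewrite ltr0n.
have /truncn_itv /andP[lo hi] : 0 <= k.+1%:R * t by rewrite mulr_ge0 // ltW.
have -> : grid k t - t =
    k.+1%:R^-1 * ((Num.truncn (k.+1%:R * t))%:R - k.+1%:R * t).
  by rewrite mulrBr mulKf // gt_eqF.
rewrite normrM ger0_norm ?invr_ge0 ?(ltW k0) // ler_piMr //.
by rewrite -[_.+1%:R in X in _ < X]natr1 in hi; rewrite ler_norml; apply/andP; split; lra.
Qed.

(* The Euler step functions converge pointwise along an ultrafilter; the
   uniform estimate below survives the limit and says at once that the limit is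
   differentiable with the right derivative, so no integral equation is needed. *)
Lemma euler_limit (G : 'cV[R]_m -> 'cV[R]_m) M z0 : continuous G ->
  (forall x, `|G x| <= M) ->
  exists2 z : R -> 'cV[R]_m, z 0 = z0 &
    forall t, 0 <= t -> forall e, 0 < e -> exists2 del, 0 < del &
      forall t1 t2, 0 <= t1 -> t1 <= t2 -> `|t1 - t| < del -> `|t2 - t| < del ->
        `|z t2 - z t1 - (t2 - t1) *: G (z t)| <= e * (t2 - t1).
Proof.
move=> cG GM; have M0 : 0 <= M by exact: le_trans (GM 0).
(* One ultrafilter serves all times at once, which removes the diagonal extraction of the
   Arzela-Ascoli argument. *)
have [U [UU Uoo]] := @ultraFilterLemma nat \oo _.
have UF : ProperFilter U by exact: ultra_proper.
have inv_small d : 0 < d -> \forall k \near U, (k.+1%:R : R)^-1 < d.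
  by move=> d0; apply: Uoo; exact: (near_infty_natSinv_lt (PosNum d0)).
have grid_cvg t : 0 <= t -> (fun k => grid k t : R) @ U --> t.
  move=> t0; apply/cvgrPdist_lt => e e0.
  apply: filterS (inv_small _ e0) => k; apply: le_lt_trans.
  by rewrite distrC grid_dist.
have grid_mono k t1 t2 : t1 <= t2 -> grid k t1 <= grid k t2 :> R.
  move=> t12; rewrite /grid ler_wpM2l ?invr_ge0 // ler_nat.
  by apply: le_truncn; rewrite ler_wpM2l.
(* The condition on [t] sits under the existential so that [choice] yields a function on the whole
   line, arbitrary at negative times. *)
have ex_lim t : exists l : 'cV[R]_m,
    0 <= t -> (fun k => euler_step G z0 k t) @ U --> l.
  have [t0|] := boolP (0 <= t); last by exists 0.
  have [|l lP] := @ultra_bounded_cvg _ U (fun k => euler_step G z0 k t)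
    (`|z0| + M * (t + 1)) UU; last by exists l.
  move=> k; rewrite -[euler_step _ _ _ _](subrK z0) addrC.
  apply: le_trans (ler_normD _ _) _; rewrite lerD2l.
  have := @euler_lipschitz G k.+1%:R^-1 z0 M 0 (Num.truncn (k.+1%:R * t)) _ GM.
  rewrite mulr0 subr0 invr_ge0 => /(_ (ler0n _ _)) h; apply: (le_trans h).
  rewrite ler_wpM2l // ger0_norm ?mulr_ge0 ?invr_ge0 //.
  have := grid_dist k t0; rewrite /grid ler_distl => /andP[_]; move/le_trans.
  apply; rewrite lerD2l invf_le1 ?ltr0n // ler1n //.
have [z zP] := choice ex_lim.
exists z.
  apply: norm_cvg_unique (zP 0 (lexx _)) _.
  apply: cvg_near_cst; apply: nearW => k.
  by rewrite /euler_step mulr0 truncn0.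
move=> t t0 e e0.
have /cvgrPdist_le /(_ _ e0) /nbhs_ballP [rho /= rho0 Grho] := cG (z t).
(* Nodes between [t1] and [t2] lie within [3 * del] of the node of [t], so the iterate moves by at
   most [M * (3 * del)], which is below [(M + 1) * (4 * del) = rho / 2]; the other half of [rho]
   pays for the distance from the iterate at [t] to [z t]. *)
pose del := rho / (8 * (M + 1)).
have del0 : 0 < del by rewrite divr_gt0 // mulr_gt0 // ltr_wpDl.
exists del => // t1 t2 t10 t12 t1t t2t; have t20 := le_trans t10 t12.
have c2 := zP _ t20; have c1 := zP _ t10.
apply: (@ler_cvg_to _ U _ _
  (fun k => `|euler_step G z0 k t2 - euler_step G z0 k t1
              - (grid k t2 - grid k t1) *: G (z t)|)
  (fun k => e * (grid k t2 - grid k t1))).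
- apply: cvg_norm; apply: cvgB; first exact: cvgB.
  by apply: (@cvgZr_tmp _ _ _ U); apply: cvgB; exact: grid_cvg.
- by apply: (@cvgMl_tmp _ _ U); apply: cvgB; exact: grid_cvg.
have rho2 : 0 < rho / 2 by rewrite divr_gt0.
have nzt := @cvgr_dist_lt _ _ _ U _ _ _ (zP _ t0) _ rho2.
near=> k.
have kdel : (k.+1%:R : R)^-1 < del by near: k; exact: inv_small.
have zt : `|z t - euler_step G z0 k t| < rho / 2 by near: k; exact: nzt.
apply: euler_increment; rewrite ?invr_ge0 //.
  by apply: le_truncn; rewrite ler_wpM2l.
move=> l /andP[l1 l2]; rewrite distrC; apply: Grho.
rewrite -ball_normE /ball_ /=.
have -> : z t - euler G k.+1%:R^-1 z0 l = (z t - euler_step G z0 k t) +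
   - (euler G k.+1%:R^-1 z0 l - euler_step G z0 k t).
  by rewrite opprB addrA subrK.
apply: (le_lt_trans (ler_normD _ _)); rewrite normrN.
have := @euler_lipschitz G k.+1%:R^-1 z0 M (Num.truncn (k.+1%:R * t)) l _ GM.
rewrite invr_ge0 => /(_ (ler0n _ _)) h.
rewrite [ltRHS](splitr rho) ltr_leD // (le_trans h) //.
have dist3 : `|k.+1%:R^-1 * l%:R - k.+1%:R^-1 * (Num.truncn (k.+1%:R * t))%:R|
    <= 3 * del.
  have g1 : grid k t1 <= k.+1%:R^-1 * l%:R.
    by rewrite /grid ler_wpM2l ?invr_ge0 // ler_nat.
  have g2 : k.+1%:R^-1 * l%:R <= grid k t2.
    by rewrite /grid ler_wpM2l ?invr_ge0 // ler_nat ltnW.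
  have := grid_dist k t10; have := grid_dist k t20; have := grid_dist k t0.
  rewrite -/(grid k t) !ler_norml; move: t1t t2t; rewrite !ltr_norml.
  move: kdel g1 g2; rewrite -?/(grid k t).
  move: (k.+1%:R^-1 * l%:R : R) (grid k t : R) (grid k t1 : R) (grid k t2 : R) (k.+1%:R^-1 : R) => a b b1 b2 c.
  move=> ? ? ? /andP[? ?] /andP[? ?] /andP[? ?] /andP[? ?] /andP[? ?].
  by apply/andP; split; lra.
apply: (@le_trans _ _ (M * (3 * del))); first by rewrite ler_wpM2l.
apply: (@le_trans _ _ ((M + 1) * (4 * del))).
  by apply: ler_pM => //; [rewrite mulr_ge0 // ltW|rewrite lerDl|lra].
rewrite /del le_eqVlt; apply/orP; left; apply/eqP; field.
by rewrite gt_eqF // ltr_wpDl.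
Unshelve. all: by end_near. Qed.

Lemma peano (G : 'cV[R]_m -> 'cV[R]_m) M z0 : continuous G ->
  (forall x, `|G x| <= M) -> exists z : R -> 'cV[R]_m, solution G z0 z.
Proof.
move=> cG GM; have [z zz0 zP] := euler_limit z0 cG GM.
have key t e : 0 <= t -> 0 < e -> exists2 del, 0 < del &
    forall s, 0 <= s -> `|s - t| < del ->
    `|z s - z t - (s - t) *: G (z t)| <= e * `|s - t|.
  move=> t0 e0; have [del del0 zt] := zP t t0 e e0; exists del => // s s0 st.
  have [ts|/ltW ts] := leP t s.
    rewrite (@ger0_norm _ (s - t)) ?subr_ge0 //.
    by apply: zt; rewrite // subrr normr0.
  rewrite (@ler0_norm _ (s - t)) ?subr_le0 // opprB.
  have := zt s t s0 ts st; rewrite subrr normr0 => /(_ del0).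
  rewrite -[X in X <= _ -> _]normrN; congr (`|_| <= _).
  by apply/colP => i; rewrite !mxE; ring.
exists z; split => //.
  apply/subspace_continuousP => t; rewrite /= in_itv /= andbT => t0.
  apply/cvgrPdist_le => e e0.
  have [del del0 zt] := key t 1 t0 ltr01.
  have M0 : 0 <= M by exact: le_trans (GM 0).
  have M1 : 0 < M + 1 by rewrite ltr_wpDl.
  near=> s; have s0 : 0 <= s.
    by have : (`[0, +oo[%classic : set R) s;
      [near: s; exact: withinT|rewrite /= in_itv /= andbT].
  have sdel : `|s - t| < del.
    rewrite distrC; near: s; apply: cvg_within.
    by apply: (@cvgr_dist_lt _ _ _ (nbhs t) _ id) => //; exact: cvg_id.
  have se : `|s - t| < e / (M + 1).
    rewrite distrC; near: s; apply: cvg_within.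
    by apply: (@cvgr_dist_lt _ _ _ (nbhs t) _ id); [exact: cvg_id|rewrite divr_gt0].
  rewrite distrC -[z s - z t](subrK ((s - t) *: G (z t))).
  apply: le_trans (ler_normD _ _) _; rewrite normrZ.
  have := zt s s0 sdel; rewrite mul1r => h.
  have hG : `|s - t| * `|G (z t)| <= `|s - t| * M by rewrite ler_wpM2l.
  have : `|s - t| * (M + 1) <= e by rewrite -ler_pdivlMr // ltW.
  by lra.
move=> t t0.
suff cv : (h^-1 *: ((z \o shift t) (h *: (1 : R)) - z t)) @[h --> 0^'] --> G (z t).
  by apply: DeriveDef; [exact: cvgP cv|exact: cvg_lim cv].
apply/cvgrPdist_le => e e0.
have [del del0 zt] := key t e (ltW t0) e0.
near=> h; have h0 : h != 0 by near: h; exact: nbhs_dnbhs_neq.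
have hd : `|h| < del by near: h; exact: dnbhs0_lt.
(* This keeps [h + t] in the half-line on which [key] speaks, so the derivative is two-sided. *)
have ht : `|h| < t by near: h; exact: dnbhs0_lt.
have hn : 0 < `|h| by rewrite normr_gt0.
have := zt (h + t); rewrite addrK /= /shift scaler1.
have -> : 0 <= h + t.
  by move: ht; rewrite ltr_norml => /andP[]; lra.
move=> /(_ isT hd) {}zt.
rewrite distrC -(ler_pM2l hn) -normrZ scalerBr scalerA divff // scale1r mulrC.
by rewrite mulrC (mulrC _ e).
Unshelve. all: by end_near. Qed.

End peano.

(** * Derivatives along curves and scalar differential inequalities *)

Section curves.
Context {R : realType}.

Lemma is_derive_coord m (z : R -> 'cV[R]_m) (t : R) (v : 'cV[R]_m) i :
  is_derive t 1 z v -> is_derive t 1 (fun s => z s i 0) (v i 0).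
Proof.
move=> [dz vz].
suff cv : (h^-1 *: (((fun s => z s i 0) \o shift t) (h *: (1 : R)) - z t i 0))
    @[h --> 0^'] --> v i 0.
  by apply: DeriveDef; [exact: cvgP cv|exact: cvg_lim cv].
have {dz} : (h^-1 *: ((z \o shift t) (h *: (1 : R)) - z t)) @[h --> 0^'] --> v.
  by rewrite -vz; exact: dz.
move=> /(@cvg_comp _ _ _ _ (fun M : 'cV[R]_m => M i 0) _ _) h.
have := h _ (@coord_continuous R m 1 i 0 v).
by apply: cvg_trans; apply: near_eq_cvg; near=> s; rewrite /= !mxE.
Unshelve. all: by end_near. Qed.

Lemma is_derive_dot m (u w : R -> 'cV[R]_m) (t : R) (u' w' : 'cV[R]_m) :
  (forall i, is_derive t 1 (fun s => u s i 0) (u' i 0)) ->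
  (forall i, is_derive t 1 (fun s => w s i 0) (w' i 0)) ->
  is_derive t 1 (fun s => dot (u s) (w s)) (dot u' (w t) + dot (u t) w').
Proof.
move=> du dw.
have -> : (fun s => dot (u s) (w s)) =
    \sum_(i < m) ((fun s => u s i 0) * (fun s => w s i 0)).
  by apply/funext => s; rewrite fct_sumE dotE.
apply: is_derive_eq.
rewrite !dotE -big_split /=; apply: eq_bigr => i _.
by rewrite /GRing.scale /= addrC (mulrC (w t i 0)).
Qed.

Lemma is_derive_mulmx_coord m p (P : 'M[R]_(p, m)) (z : R -> 'cV[R]_m) (t : R) (v : 'cV[R]_m) i :
  (forall j, is_derive t 1 (fun s => z s j 0) (v j 0)) ->
  is_derive t 1 (fun s => (P *m z s) i 0) ((P *m v) i 0).
Proof.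
move=> dz.
have -> : (fun s => (P *m z s) i 0) = \sum_(j < m) (P i j \*: (fun s => z s j 0)).
  by apply/funext => s; rewrite fct_sumE mxE.
apply: is_derive_eq.
by rewrite mxE.
Qed.

Lemma is_derive_quad m (P : 'M[R]_m) (u : R -> 'cV[R]_m) (t : R) (v : 'cV[R]_m) :
  P^T = P -> (forall i, is_derive t 1 (fun s => u s i 0) (v i 0)) ->
  is_derive t 1 (fun s => dot (u s) (P *m u s)) (2 * dot (u t) (P *m v)).
Proof.
move=> PT du.
have dPu i := is_derive_mulmx_coord P i du.
have h := is_derive_dot du dPu; apply: (is_derive_eq h).
have -> : dot v (P *m u t) = dot (u t) (P *m v) by rewrite dot_mulmx PT dotC.
by rewrite mulr_natl mulr2n.
Qed.

End curves.

Section scalar_inequalities.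
Context {R : realType}.
Implicit Types (f g w : R -> R) (a b s t k : R).

Lemma is_derive_le0_nonincr f g a b : a <= b ->
  {within `[a, b], continuous f} ->
  (forall t, a < t < b -> is_derive t 1 f (g t)) ->
  (forall t, a < t < b -> g t <= 0) -> f b <= f a.
Proof.
rewrite le_eqVlt => /predU1P[-> //|ab] cf df g0.
have df' t : t \in `]a, b[ -> is_derive t 1 f (g t).
  by rewrite in_itv /=; exact: df.
have [c cab fab] := MVT ab df' cf.
rewrite -subr_le0 fab; apply: mulr_le0_ge0; last by rewrite subr_ge0 ltW.
by apply: g0; rewrite in_itv in cab.
Qed.

Lemma is_derive_le0_nonincr_cc f g a b : a <= b ->
  (forall t, a <= t <= b -> is_derive t 1 f (g t)) ->
  (forall t, a <= t <= b -> g t <= 0) -> f b <= f a.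
Proof.
move=> ab df g0; apply: (@is_derive_le0_nonincr f g) => //.
- apply: derivable_within_continuous => t; rewrite in_itv /= => tab.
  by have [] := df _ tab.
- by move=> t /andP[at_ tb]; apply: df; rewrite !ltW.
- by move=> t /andP[at_ tb]; apply: g0; rewrite !ltW.
Qed.

Lemma is_derive_linear k t : is_derive t 1 (fun x : R => k * x) k.
Proof.
apply: (is_derive_eq (@is_deriveZ _ _ _ id k t 1 1 _)).
by rewrite /GRing.scale /= mulr1.
Qed.

(** The product of [f] and exp(- C t) has nonpositive derivative, so it cannot rise above its
    initial value 0. *)
Lemma gronwall_eq0 f g C T : 0 <= T ->
  {within `[0, T], continuous f} ->
  (forall t, 0 < t < T -> is_derive t 1 f (g t)) ->
  (forall t, 0 < t < T -> g t <= C * f t) ->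
  f 0 = 0 -> 0 <= f T -> f T = 0.
Proof.
move=> T0 cf df gC f0 fT; apply/eqP; rewrite eq_le fT andbT.
have dE s : is_derive s 1 (fun x : R => expR (- C * x)) (expR (- C * s) * - C).
  exact: (is_derive1_comp (is_derive_expR (- C * s)) (is_derive_linear (- C) s)).
have := @is_derive_le0_nonincr (f * (fun x => expR (- C * x)))
  (fun s => f s *: (expR (- C * s) * - C) + expR (- C * s) *: g s) 0 T T0.
have cE : {within `[0, T], continuous (fun x : R => expR (- C * x))}.
  by apply: derivable_within_continuous => t _; have [] := dE t.
have cfE : {within `[0, T], continuous (f * (fun x => expR (- C * x)))}.
  by move=> x; apply: continuousM; [exact: cf|exact: cE].
move=> /(_ cfE) h; have {h} : (f * (fun x : R => expR (- C * x))) T <= 0.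
  rewrite (le_trans (h _ _)) //.
  - by move=> t tT; apply: is_deriveM; exact: df.
  - move=> t tT; have := gC t tT; have := expR_gt0 (- C * t).
    rewrite /GRing.scale /= => E0 h2.
    have : expR (- C * t) * (g t - C * f t) <= 0.
      by rewrite mulr_ge0_le0 ?(ltW E0) // subr_le0.
    by lra.
  - by rewrite -[leLHS]/(f 0 * expR (- C * 0)) f0 mul0r.
by rewrite -[leLHS]/(f T * expR (- C * T)) pmulr_lle0 // expR_gt0.
Qed.

(* [w^a] decreases and [w^(-b)] increases at least linearly: the latter brings
   [w] below 1 within time 1/(b k2), the former then kills it within 1/(a k1). *)
Lemma fixed_time_extinction w g k1 k2 a b :
  0 < k1 -> 0 < k2 -> 0 < a -> 0 < b ->
  (forall t, 0 < t -> is_derive t 1 w (g t)) ->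
  (forall t, 0 <= t -> 0 <= w t) ->
  (forall s t, 0 <= s -> s <= t -> w t <= w s) ->
  (forall t, 0 < t -> 0 < w t ->
    g t <= - ((k1 * w t `^ (- a) + k2 * w t `^ b) * w t)) ->
  forall t, 1 + (b * k2)^-1 + (a * k1)^-1 <= t -> w t = 0.
Proof.
move=> k10 k20 a0 b0 dw w0 wmono gle t ht.
have bk0 : 0 < b * k2 by rewrite mulr_gt0.
have ak0 : 0 < a * k1 by rewrite mulr_gt0.
have bk1 : 0 < (b * k2)^-1 by rewrite invr_gt0.
have ak1 : 0 < (a * k1)^-1 by rewrite invr_gt0.
(* The comparison starts at time 1, as no derivative of [w] is given at time 0. *)
set T := 1 + (b * k2)^-1 in ht *; have T1 : 1 <= T by rewrite lerDl ltW.
have Tt : T <= t by lra.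
have t0 : 0 < t by lra.
apply/eqP; rewrite eq_le w0 ?(ltW t0) // andbT leNgt; apply/negP => wt.
have wpos s : 0 < s -> s <= t -> 0 < w s.
  by move=> s0 st; exact: lt_le_trans (wmono _ _ (ltW s0) st).
have dpow p s : 0 < s -> s <= t ->
    is_derive s 1 (fun x => w x `^ p) (p * w s `^ (p - 1) * g s).
  move=> s0 st.
  exact: (is_derive1_comp (is_derive1_powR p (wpos s s0 st)) (dw s s0)).
(* The chain rule leaves the powers p, q and 1 of [w s]; they cancel when the exponents sum to 0,
   and a constant rate remains. *)
have pw p q r s : 0 < s -> s <= t -> p + q + 1 = 0 :> R ->
    w s `^ p * r * w s `^ q * w s = r.
  move=> s0 st pq; have ws := wpos s s0 st.
  have pq1 : w s `^ p * w s `^ q * w s = 1.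
    have D x y : w s `^ (x + y) = w s `^ x * w s `^ y.
      by rewrite powRD // (gt_eqF ws) implybT.
    by rewrite -{3}[w s](powRr1 (ltW ws)) -!D pq powRr0.
  by rewrite -[RHS]mulr1 -pq1; ring.
have glow s : 0 < s -> s <= t -> g s <= - (k1 * w s `^ (- a) * w s) /\
    g s <= - (k2 * w s `^ b * w s).
  move=> s0 st; have ws := wpos s s0 st; have := gle s s0 ws.
  have : 0 <= k1 * w s `^ (- a) * w s by rewrite !mulr_ge0 ?powR_ge0 // ltW.
  have : 0 <= k2 * w s `^ b * w s by rewrite !mulr_ge0 ?powR_ge0 // ltW.
  by move=> *; split; lra.
(* Otherwise w^(-b) is at most 1 at time [T], although it is positive at time 1 and has since grown
   by at least [b * k2 * (T - 1) = 1]. *)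
have small : w T < 1.
  rewrite ltNge; apply/negP => w1.
  have : b * k2 * T - w T `^ (- b) <= b * k2 * 1 - w 1 `^ (- b).
    apply: (@is_derive_le0_nonincr_cc (fun x => b * k2 * x - w x `^ (- b))
      (fun s => b * k2 - (- b) * w s `^ (- b - 1) * g s)) => // s /andP[s1 sT];
      have s0 : 0 < s by lra.
      apply: is_deriveB; first exact: is_derive_linear.
      by apply: dpow => //; exact: le_trans Tt.
    have st := le_trans sT Tt.
    have [_ gs] := glow s s0 st.
    have : b * w s `^ (- b - 1) * g s <= - (b * k2).
      rewrite -[leRHS](pw (- b - 1) b _ s) //; last by lra.
      have := powR_ge0 (w s) (- b - 1) => P0.
      have : b * w s `^ (- b - 1) * (g s + k2 * w s `^ b * w s) <= 0.
        by apply: mulr_ge0_le0; [rewrite mulr_ge0 // ltW|lra].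
      by lra.
    by lra.
  have : w T `^ (- b) <= w T `^ 0 by rewrite ler_powR // oppr_le0 ltW.
  have : 0 < w 1 `^ (- b) by rewrite powR_gt0 // wpos //; lra.
  rewrite powRr0.
  have : b * k2 * T = b * k2 + 1 by rewrite /T mulrDr mulr1 divff // gt_eqF.
  by lra.
(* From a value below 1 at [T], w^a falls at rate at least [a * k1] for a time at least 1 / (a k1),
   which would make it negative. *)
have : w t `^ a + a * k1 * t <= w T `^ a + a * k1 * T.
  apply: (@is_derive_le0_nonincr_cc (fun x => w x `^ a + a * k1 * x)
      (fun s => a * w s `^ (a - 1) * g s + a * k1)) => // s /andP[Ts st];
      have s0 : 0 < s by lra.
    by apply: is_deriveD; [exact: dpow|exact: is_derive_linear].
  have [gs _] := glow s s0 st.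
  have : a * w s `^ (a - 1) * g s <= - (a * k1).
    rewrite -[leRHS](pw (a - 1) (- a) _ s) //; last by lra.
    have := powR_ge0 (w s) (a - 1) => P0.
    have : a * w s `^ (a - 1) * (g s + k1 * w s `^ (- a) * w s) <= 0.
      by apply: mulr_ge0_le0; [rewrite mulr_ge0 // ltW|lra].
    by lra.
  by lra.
have : w T `^ a < 1 `^ a.
  have T0 : 0 <= T by lra.
  by rewrite gt0_ltr_powR // nnegrE ?w0.
have := powR_ge0 (w t) a.
have : a * k1 * (t - T) >= 1.
  by rewrite -ler_pdivrMl // mulr1; lra.
by rewrite powR1 /=; lra.
Qed.

End scalar_inequalities.

(** * The scaled flow of a strongly monotone Lipschitz field *)

Section scaling_profile.
Context {R : realType}.
Variables (eta1 eta2 l1 l2 : R).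
Hypotheses (eta1_gt0 : 0 < eta1) (eta2_gt0 : 0 < eta2).
Hypotheses (l1_gt0 : 0 < l1) (l1_lt1 : l1 < 1) (l2_gt0 : 0 < l2).

Implicit Types r s e a b : R.

Definition profile (r : R) : R := eta1 * r `^ (- l1) + eta2 * r `^ l2.

Let e1_gt0 : 0 < 1 - l1. Proof. by rewrite subr_gt0. Qed.
Let e2_gt0 : 0 < 1 + l2. Proof. by rewrite addr_gt0. Qed.

Lemma profile_ge0 r : 0 <= profile r.
Proof. by rewrite addr_ge0 // mulr_ge0 ?powR_ge0 // ltW. Qed.

(** This is the norm of the scaled field. Since l1 < 1 both exponents are positive, so it is
    monotone and tends to 0 with [r], unlike [profile] itself. *)
Lemma profileM r : 0 <= r ->
  profile r * r = eta1 * r `^ (1 - l1) + eta2 * r `^ (1 + l2).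
Proof.
rewrite le_eqVlt => /predU1P[<-|r0].
  by rewrite mulr0 !powR0 ?mulr0 ?addr0 // ?(gt_eqF e1_gt0) ?(gt_eqF e2_gt0).
rewrite /profile mulrDl; congr (_ + _); rewrite -mulrA; congr (_ * _);
  by rewrite addrC powRD ?(gt_eqF r0) ?implybT // powRr1 // ltW.
Qed.

Lemma profileM_le r s : 0 <= r -> r <= s -> profile r * r <= profile s * s.
Proof.
move=> r0 rs; have s0 := le_trans r0 rs; rewrite !profileM //.
by rewrite lerD // ler_pM2l //; apply: ge0_ler_powR; rewrite ?nnegrE ?(ltW e1_gt0) ?(ltW e2_gt0) //.
Qed.

Lemma profileM_small e : 0 < e ->
  exists2 del, 0 < del & forall r, 0 <= r -> r < del -> profile r * r <= e.
Proof.
move=> e0; have s0 : 0 < eta1 + eta2 by rewrite addr_gt0.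
have p0 : 0 < 1 - l1 by rewrite subr_gt0.
(* Below 1 the power 1 + l2 is dominated by the power 1 - l1, so the product is at most (eta1 +
   eta2) r^(1 - l1); the second entry makes this at most [e]. *)
exists (Num.min 1 ((e / (eta1 + eta2)) `^ (1 - l1)^-1)).
  by rewrite lt_min ltr01 powR_gt0 // divr_gt0.
move=> r r0; rewrite lt_min => /andP[r1 re]; rewrite profileM //.
have [->|rn0] := eqVneq r 0.
  by rewrite !powR0 ?mulr0 ?addr0 ?(ltW e0) // ?(gt_eqF e1_gt0) ?(gt_eqF e2_gt0).
have rp : 0 < r by rewrite lt_def rn0.
have le12 : 1 - l1 <= 1 + l2 by move: l1_gt0 l2_gt0; lra.
have h1 : r `^ (1 + l2) <= r `^ (1 - l1) by apply: ger_powR => //; rewrite rp ltW.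
have h2 : r `^ (1 - l1) <= e / (eta1 + eta2).
  have -> : e / (eta1 + eta2) =
      ((e / (eta1 + eta2)) `^ (1 - l1)^-1) `^ (1 - l1).
    by rewrite -powRrM mulVf ?lt0r_neq0 // powRr1 // divr_ge0 // ltW.
  by apply: ge0_ler_powR; rewrite ?nnegrE ?powR_ge0 // ltW.
have : (eta1 + eta2) * r `^ (1 - l1) <= e by rewrite mulrC -ler_pdivlMr.
have : eta2 * r `^ (1 + l2) <= eta2 * r `^ (1 - l1) by rewrite ler_pM2l.
by lra.
Qed.

Lemma is_derive_profile r : 0 < r ->
  is_derive r 1 profile (eta1 * (- l1 * r `^ (- l1 - 1)) + eta2 * (l2 * r `^ (l2 - 1))).
Proof.
move=> r0.
apply: (@is_deriveD _ _ _ (fun x => eta1 * x `^ (- l1)) (fun x => eta2 * x `^ l2)).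
  exact: (@is_deriveZ _ _ _ _ eta1 _ _ _ (is_derive1_powR (- l1) r0)).
exact: (@is_deriveZ _ _ _ _ eta2 _ _ _ (is_derive1_powR l2 r0)).
Qed.

Lemma profile_continuous r : 0 < r -> {for r, continuous profile}.
Proof.
move=> r0; apply: differentiable_continuous; apply/derivable1_diffP.
by have [] := is_derive_profile r0.
Qed.

Lemma profile_lipschitz a b : 0 < a -> exists2 k, 0 <= k &
  forall r s, a <= r <= b -> a <= s <= b ->
    `|profile r - profile s| <= k * `|r - s|.
Proof.
move=> a0.
(* A bound for the derivative on [a, b]. The exponent [l2 - 1] has unknown sign, so the values at
   both endpoints are added; [- l1 - 1] is negative and needs only [a]. *)
pose k := eta1 * (l1 * a `^ (- l1 - 1)) + eta2 * (l2 * (a `^ (l2 - 1) + b `^ (l2 - 1))).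
have k0 : 0 <= k.
  by rewrite addr_ge0 // !mulr_ge0 ?addr_ge0 ?powR_ge0 // ltW.
exists k => // r s; wlog rs : r s / r <= s.
  move=> wl ra sa; have [rs|/ltW sr] := leP r s; first exact: wl.
  by rewrite distrC (distrC r); exact: wl.
move=> /andP[ar rb] /andP[as_ sb].
have der t : r <= t <= s -> is_derive t 1 profile
    (eta1 * (- l1 * t `^ (- l1 - 1)) + eta2 * (l2 * t `^ (l2 - 1))).
  by move=> /andP[rt _]; apply: is_derive_profile; lra.
have cont : {within `[r, s], continuous profile}.
  by apply: derivable_within_continuous => t; rewrite in_itv /= => /der[].
have der' t : t \in `]r, s[ -> is_derive t 1 profile
    (eta1 * (- l1 * t `^ (- l1 - 1)) + eta2 * (l2 * t `^ (l2 - 1))).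
  by rewrite in_itv /= => /andP[rt ts]; apply: der; rewrite !ltW.
have [t] := MVT_segment rs der' cont; rewrite in_itv /= => /andP[rt ts].
rewrite distrC (distrC r) => ->; rewrite normrM ler_wpM2r //.
have at_ : a <= t by lra.
have t0 : 0 < t by lra.
have h1 : t `^ (- l1 - 1) <= a `^ (- l1 - 1).
  have -> : - l1 - 1 = - (l1 + 1) :> R by lra.
  have l0 : 0 <= l1 + 1 by move: l1_gt0; lra.
  rewrite !powRN lef_pV2 ?posrE ?powR_gt0 //.
  by apply: ge0_ler_powR; rewrite ?nnegrE // ltW.
have h2 : t `^ (l2 - 1) <= a `^ (l2 - 1) + b `^ (l2 - 1).
  have pa := powR_ge0 a (l2 - 1); have pb := powR_ge0 b (l2 - 1).
  have [l21|l21] := leP 1 l2.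
    have l0 : 0 <= l2 - 1 by lra.
    have tb : t <= b by lra.
    have : t `^ (l2 - 1) <= b `^ (l2 - 1).
      by apply: ge0_ler_powR; rewrite ?nnegrE // (le_trans (ltW t0)).
    by lra.
  have : t `^ (l2 - 1) <= a `^ (l2 - 1).
    have -> : l2 - 1 = - (1 - l2) :> R by lra.
    have l0 : 0 <= 1 - l2 by lra.
    rewrite !powRN lef_pV2 ?posrE ?powR_gt0 //.
    by apply: ge0_ler_powR; rewrite ?nnegrE // ltW.
  by lra.
have pt p : 0 <= t `^ p by exact: powR_ge0.
apply: (le_trans (ler_normD _ _)); rewrite mulNr mulrN normrN.
rewrite !ger0_norm ?mulr_ge0 ?(ltW l1_gt0) ?(ltW l2_gt0) ?(ltW eta1_gt0) ?(ltW eta2_gt0) //.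
by rewrite lerD // ler_pM2l // ler_pM2l.
Qed.

End scaling_profile.

(** * Strongly monotone Lipschitz fields in the metric of [P]: existence of a zero *)

Section strongly_monotone.
Context {R : realType} {m : nat}.
Variables (F : 'cV[R]_m -> 'cV[R]_m) (P : 'M[R]_m) (p1 p2 c K : R).
Hypotheses (p1_gt0 : 0 < p1) (p2_gt0 : 0 < p2) (c_gt0 : 0 < c) (K_gt0 : 0 < K).
Hypothesis P_sym : P^T = P.
Hypothesis P_lower : forall u, p1 * dot u u <= dot u (P *m u).
Hypothesis P_upper : forall u, dot u (P *m u) <= p2 * dot u u.
Hypothesis F_mono : forall z w,
  dot (z - w) (P *m (F z - F w)) <= - c * dot (z - w) (z - w).
Hypothesis F_lip : forall z w,
  dot (F z - F w) (F z - F w) <= K * dot (z - w) (z - w).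

Let V u := dot u (P *m u).

(** Young's inequality with weight [c] on the monotonicity bound absorbs half of its left side. The
    result bounds the Euler iterates, makes the zero unique and bounds |F| below by the distance to
    it. *)
Lemma monotone_inverse_lipschitz : exists2 k, 0 < k &
  forall z w, dot (z - w) (z - w) <= k * dot (F z - F w) (F z - F w).
Proof.
have [C C0 hC] := mulmx_dot_bounded P.
exists (C / c ^+ 2); first by rewrite divr_gt0 // exprn_gt0.
move=> z w; have := F_mono z w; have := hC (F z - F w).
move: (z - w) (F z - F w) => x y hy hx.
have := @dot_AMGM _ _ c (- x) (P *m y) c_gt0; rewrite !dotNl dotNr opprK => h.
have h2 : c * dot x x <= c^-1 * (C * dot y y).
  have : c^-1 * dot (P *m y) (P *m y) <= c^-1 * (C * dot y y).
    by rewrite ler_wpM2l // invr_ge0 ltW.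
  by lra.
rewrite -(ler_pM2l c_gt0); apply: (le_trans h2); rewrite le_eqVlt; apply/orP; left.
by apply/eqP; field; rewrite gt_eqF.
Qed.

Lemma monotone_continuous : continuous F.
Proof.
apply: (@enorm_lipschitz_continuous _ _ _ _ (Num.sqrt K)); rewrite ?sqrtr_ge0 //.
by move=> x y; exact: enorm_le_sqrt (ltW K_gt0) (F_lip x y).
Qed.

(* The step c / (p2 K) minimizes the quadratic -2 c e + p2 K e^2 that bounds the
   change of [V (F z)] over a step e. *)
Lemma monotone_step z : V (F (z + (c / (p2 * K)) *: F z)) <=
  (1 - c ^+ 2 / (p2 ^+ 2 * K)) * V (F z).
Proof.
set e := c / (p2 * K); have e0 : 0 < e by rewrite divr_gt0 // mulr_gt0.
set w := z + e *: F z; have wz : w - z = e *: F z by rewrite /w addrC addKr.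
have := F_mono w z; have := F_lip w z; rewrite wz !dotZl !dotZr.
have -> : F w = F z + (F w - F z) by rewrite addrC subrK.
move: (F z) (F w - F z) => u D; rewrite addrC addKr => hK hm.
have {}hm : dot u (P *m D) <= - c * e * dot u u.
  by rewrite -(ler_pM2l e0); apply: (le_trans hm); lra.
have -> : V (u + D) = V u + 2 * dot u (P *m D) + V D.
  rewrite /V mulmxDr dotDl !dotDr.
  have -> : dot D (P *m u) = dot u (P *m D) by rewrite dot_mulmx P_sym dotC.
  by ring.
(* For this [e] one has [p2 * K * e ^+ 2 = c * e]: the quadratic term consumes exactly half of the
   gain [2 * c * e * dot u u]. *)
have VD : V D <= c * e * dot u u.
  apply: (le_trans (P_upper D)).
  apply: (@le_trans _ _ (p2 * (K * (e * (e * dot u u))))).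
    by rewrite ler_pM2l.
  rewrite le_eqVlt; apply/orP; left; apply/eqP; rewrite /e; field.
  by rewrite !gt_eqF.
have ce : c * e * dot u u >= c ^+ 2 / (p2 ^+ 2 * K) * V u.
  have -> : c ^+ 2 / (p2 ^+ 2 * K) * V u = c * e * (p2^-1 * V u).
    by rewrite /e; field; rewrite !gt_eqF.
  rewrite (ler_pM2l (mulr_gt0 c_gt0 e0)) ler_pdivrMl //; exact: P_upper.
by lra.
Qed.

(** Along the Euler iteration [F] tends to 0 geometrically and the iterates stay bounded, so their
    limit along an ultrafilter is a zero by continuity. *)
Lemma monotone_zero : exists zs, F zs = 0.
Proof.
pose z k := iter k (fun z => z + (c / (p2 * K)) *: F z) 0.
(* The maximum makes [q] nonnegative without comparing c^2 with p2^2 K. *)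
pose q := Num.max 0 (1 - c ^+ 2 / (p2 ^+ 2 * K)).
have V0 u : 0 <= V u.
  by apply: le_trans (P_lower u); rewrite mulr_ge0 ?dot_ge0 // ltW.
have q0 : 0 <= q by rewrite le_max lexx.
have q1 : q < 1.
  by rewrite gt_max ltr01 gtrBl divr_gt0 ?mulr_gt0 ?exprn_gt0.
have decay k : V (F (z k)) <= q ^+ k * V (F 0).
  elim: k => [|k IH]; first by rewrite expr0 mul1r.
  apply: (le_trans (monotone_step (z k))); rewrite [q ^+ _]exprS -mulrA.
  apply: (@le_trans _ _ (q * V (F (z k)))); last by rewrite ler_wpM2l.
  by rewrite ler_wpM2r // le_max lexx orbT.
have enF k : dot (F (z k)) (F (z k)) <= p1^-1 * (q ^+ k * V (F 0)).
  by rewrite ler_pdivlMl //; exact: le_trans (P_lower _) (decay k).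
have [U [UU Uoo]] := @ultraFilterLemma nat \oo _.
have UF : ProperFilter U by exact: ultra_proper.
have [L L0 hL] := monotone_inverse_lipschitz.
pose B := L * (2 * (p1^-1 * V (F 0)) + 2 * dot (F 0) (F 0)).
(* From r^2 <= B follows r <= B + 1, which avoids a square root. *)
have zB k : `|z k| <= B + 1.
  have zkB : dot (z k) (z k) <= B.
    have := hL (z k) 0; rewrite subr0 => h; apply: (le_trans h).
    rewrite ler_wpM2l ?(ltW L0) //.
    have h1 : dot (F (z k)) (F (z k)) <= p1^-1 * V (F 0).
      apply: le_trans (enF k) _; rewrite ler_wpM2l ?invr_ge0 ?(ltW p1_gt0) //.
      by rewrite ler_piMl // exprn_ile1 // ltW.
    have := dot_ge0 (F (z k) + F 0); move: h1.
    rewrite !dotDl !dotDr !dotNl !dotNr (dotC (F 0) (F (z k))); lra.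
  have := sqr_mx_norm_le_dot (z k); move: zkB (normr_ge0 (z k)).
  move: `|z k| (dot (z k) (z k)) => r s; nra.
have [l zl] := ultra_bounded_cvg UU zB.
exists l; apply/eqP; rewrite -dot_eq0 eq_le dot_ge0 andbT.
have Fl : (fun k => F (z k)) @ U --> F l.
  by apply: cvg_comp zl _; exact: monotone_continuous.
have FF_cvg : (fun k => dot (F (z k)) (F (z k))) @ U --> dot (F l) (F l).
  exact: (@cvg_dot R nat U m _ _ _ _ _ Fl Fl).
have q_cvg : (fun k => q ^+ k) @ U --> (0 : R).
  by move=> A A0; apply: Uoo; apply: cvg_expr A0; rewrite ger0_norm.
have qV_cvg : (fun k => p1^-1 * (q ^+ k * V (F 0))) @ U --> (0 : R).
  have -> : 0 = p1^-1 * (0 * V (F 0)) by rewrite mul0r mulr0.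
  by apply: (@cvgMl_tmp _ _ U); apply: (@cvgMr_tmp _ _ U).
by apply: (ler_cvg_to FF_cvg qV_cvg); apply: nearW.
Qed.

(** * The scaled field: energy decay, existence, uniqueness and settling time *)

Variables (zs : 'cV[R]_m) (eta1 eta2 l1 l2 : R).
Hypothesis F_zs : F zs = 0.
Hypotheses (eta1_gt0 : 0 < eta1) (eta2_gt0 : 0 < eta2).
Hypotheses (l1_gt0 : 0 < l1) (l1_lt1 : l1 < 1) (l2_gt0 : 0 < l2).

Let sigma := profile eta1 eta2 l1 l2.
Let G z := time_scaling F eta1 eta2 l1 l2 z *: F z.
Let E z := V (z - zs).

(** The case distinction in [time_scaling] disappears: at a zero of [F] the factor multiplies the
    zero vector, whatever its value. *)
Let scaledE z : G z = sigma (enorm (F z)) *: F z.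
Proof.
by rewrite /G /time_scaling; case: eqP => [->|//]; rewrite !scaler0.
Qed.

Let F_continuous := monotone_continuous.

Let sigma_ge0 r : 0 <= sigma r. Proof. exact: profile_ge0. Qed.

Let enorm_scaled z : enorm (G z) = sigma (enorm (F z)) * enorm (F z).
Proof. by rewrite scaledE enormZ ger0_norm. Qed.

Let scaled_continuous : continuous G.
Proof.
move=> z; have eF : (fun w => enorm (F w)) @ z --> enorm (F z).
  by apply: (@continuous_comp _ _ _ F (@enorm R m) z); [exact: F_continuous|exact: enorm_continuous].
have [Fz|Fz] := eqVneq (F z) 0.
  apply: (@continuous_at_zero _ _ _ _ (fun w => enorm (F w)) z _ eF).
  - by rewrite scaledE Fz scaler0.
  - by apply/eqP; rewrite enorm_eq0 Fz.
  move=> e e0.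
  have [del del0 small] := profileM_small eta1_gt0 eta2_gt0 l1_gt0 l1_lt1 l2_gt0 e0.
  exists del => // w; rewrite ger0_norm ?enorm_ge0 // => wdel.
  apply: le_trans (mx_norm_le_enorm _) _; rewrite enorm_scaled.
  by apply: small => //; exact: enorm_ge0.
have N0 : 0 < enorm (F z) by rewrite lt_def enorm_ge0 enorm_eq0 Fz.
have -> : G = (fun w => sigma (enorm (F w)) *: F w) by apply/funext => w; exact: scaledE.
have sc : {for z, continuous (sigma \o (fun w => enorm (F w)))}.
  exact: continuous_comp eF (profile_continuous N0).
exact: (continuousZ sc (@F_continuous z)).
Qed.

Let V_ge0 u : 0 <= V u.
Proof. by apply: le_trans (P_lower u); rewrite mulr_ge0 ?dot_ge0 // ltW. Qed.

Let V_eq0 u : V u <= 0 -> u = 0.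
Proof.
move=> Vu; apply/eqP; rewrite -dot_eq0 eq_le dot_ge0 andbT.
by rewrite -(pmulr_rle0 _ p1_gt0) (le_trans (P_lower u)).
Qed.

Let E_gt0 z : (0 < E z) = (z != zs).
Proof.
apply/idP/idP => [|zzs]; first by apply: contraTneq => ->; rewrite /E subrr /V dot0l ltxx.
by rewrite ltNge; apply/negP => /V_eq0/eqP; rewrite subr_eq0 (negbTE zzs).
Qed.

Let E_eq0 z : E z = 0 -> z = zs.
Proof. by move=> Ez; apply/eqP; apply: contraT; rewrite -E_gt0 Ez ltxx. Qed.

Let dissipation z :
  dot (z - zs) (P *m G z) <= - c * sigma (enorm (F z)) * dot (z - zs) (z - zs).
Proof.
rewrite scaledE -scalemxAr dotZr mulrAC mulrC ler_wpM2r //.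
by have := F_mono z zs; rewrite F_zs subr0.
Qed.

Let dissipation_le0 z : dot (z - zs) (P *m G z) <= 0.
Proof.
apply: (le_trans (dissipation z)).
by rewrite -mulrA mulNr oppr_le0 !mulr_ge0 ?dot_ge0 // ltW.
Qed.

(** The upper bound is the Lipschitz property between [z] and [zs], the lower one its inverse form;
    [p1] and [p2] convert the distance into energy. *)
Let field_bounds : exists2 k, 0 < k & forall z,
  E z / (p2 * k) <= enorm (F z) ^+ 2 /\ enorm (F z) ^+ 2 <= K / p1 * E z.
Proof.
have [k k0 hk] := monotone_inverse_lipschitz.
exists k => // z; rewrite sqr_enorm.
have := hk z zs; have := F_lip z zs; rewrite F_zs subr0.
have := P_lower (z - zs); have := P_upper (z - zs); rewrite -/(V _) -/(E z).
move: (E z) (dot (F z) _) (dot (z - zs) _) => e N D h1 h2 h3 h4; split.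
  rewrite ler_pdivrMr ?mulr_gt0 // mulrC -mulrA (le_trans h1) // ler_pM2l //.
apply: (le_trans h3); rewrite -mulrA ler_pM2l // ler_pdivlMl //.
Qed.

(** As |F|^2 is comparable to the energy, powers of |F| become powers of [E] with halved exponents.
    The negative power uses the upper bound on |F|, the positive one the lower bound; [2 * c / p2]
    comes from turning the squared distance back into energy. *)
Let decay_rate : exists k1 k2, [/\ 0 < k1, 0 < k2 & forall z, 0 < E z ->
  2 * dot (z - zs) (P *m G z) <=
    - ((k1 * E z `^ (- (l1 / 2)) + k2 * E z `^ (l2 / 2)) * E z)].
Proof.
have [k k0 bounds] := field_bounds.
have Kp : 0 < K / p1 by rewrite divr_gt0.
have pk : 0 < (p2 * k)^-1 by rewrite invr_gt0 mulr_gt0.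
have cp : 0 < 2 * c / p2 by rewrite divr_gt0 // mulr_gt0.
exists (2 * c / p2 * (eta1 * (K / p1) `^ (- (l1 / 2)))),
  (2 * c / p2 * (eta2 * (p2 * k)^-1 `^ (l2 / 2))).
split; try by do 2!apply: mulr_gt0 => //; exact: powR_gt0.
move=> z Ez; have [lo hi] := bounds z; set N := enorm (F z) in lo hi *.
have [Ez0 Kp0 pk0] : [/\ 0 <= E z, 0 <= K / p1 & 0 <= (p2 * k)^-1] by split; exact: ltW.
have N20 : 0 < N ^+ 2 by apply: lt_le_trans lo; rewrite mulr_gt0.
have Npow p : N `^ p = (N ^+ 2) `^ (p / 2).
  rewrite -powR_mulrn ?enorm_ge0 // -powRrM; congr (_ `^ _).
  by rewrite mulrCA divff ?mulr1.
have h1 : (K / p1) `^ (- (l1 / 2)) * E z `^ (- (l1 / 2)) <= N `^ (- l1).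
  have KE : 0 < K / p1 * E z by rewrite mulr_gt0.
  rewrite Npow -powRM // mulNr !powRN lef_pV2 ?posrE ?powR_gt0 //.
  by apply: ge0_ler_powR; rewrite ?nnegrE ?(ltW N20) ?(ltW KE) // ltW ?divr_gt0.
have h2 : (p2 * k)^-1 `^ (l2 / 2) * E z `^ (l2 / 2) <= N `^ l2.
  have kE : 0 < (p2 * k)^-1 * E z by rewrite mulr_gt0.
  rewrite Npow -powRM //.
  apply: ge0_ler_powR; rewrite ?nnegrE ?(ltW N20) ?(ltW kE) //.
    by rewrite ltW ?divr_gt0.
  by rewrite mulrC.
have hs : sigma N >= eta1 * ((K / p1) `^ (- (l1 / 2)) * E z `^ (- (l1 / 2))) +
    eta2 * ((p2 * k)^-1 `^ (l2 / 2) * E z `^ (l2 / 2)).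
  by rewrite /sigma /profile lerD // ler_pM2l.
have := dissipation z; rewrite -/N => hd.
have hD : p2^-1 * E z <= dot (z - zs) (z - zs) by rewrite ler_pdivrMl //; exact: P_upper.
have s0 := sigma_ge0 N.
have hd2 : 2 * dot (z - zs) (P *m G z) <= - (2 * c / p2 * (sigma N * E z)).
  have : c * sigma N * (p2^-1 * E z) <= c * sigma N * dot (z - zs) (z - zs).
    by rewrite ler_wpM2l // mulr_ge0 // ltW.
  by lra.
apply: (le_trans hd2); rewrite lerN2 mulrDl.
have := ler_wpM2l (ltW cp) (ler_wpM2r (ltW Ez) hs); lra.
Qed.

Let E_continuous : continuous E.
Proof.
move=> z; have sub_c : {for z, continuous (fun w : 'cV[R]_m => w - zs)}.
  apply: (@lipschitz_continuous _ _ _ (fun w : 'cV[R]_m => w - zs) 1) => x y.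
  by rewrite opprB addrA subrK mul1r.
exact: (continuous_comp sub_c (@quad_continuous R m P (z - zs))).
Qed.

Let is_derive_coordB (z w : R -> 'cV[R]_m) (t : R) (u v : 'cV[R]_m) i :
  is_derive t 1 z u -> is_derive t 1 w v ->
  is_derive t 1 (fun s => (z s - w s) i 0) ((u - v) i 0).
Proof.
move=> dz dw; rewrite !mxE.
have -> : (fun s => (z s - w s) i 0) = (fun s => z s i 0) - (fun s => w s i 0).
  by apply/funext => s; rewrite !mxE.
by apply: is_deriveB; exact: is_derive_coord.
Qed.

(** The field [H] is arbitrary because both [G] and its cutoff are meant. *)
Let energy_derive H z0 z (t : R) : solution H z0 z -> 0 < t ->
  is_derive t 1 (fun s => E (z s)) (2 * dot (z t - zs) (P *m H (z t))).
Proof.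
move=> [_ _ dz] t0; apply: (@is_derive_quad _ _ P (fun s => z s - zs)) => // i.
have := @is_derive_coordB z (fun=> zs) t _ _ i (dz t t0) (is_derive_cst zs t 1).
by rewrite subr0.
Qed.

Let energy_within H z0 z : solution H z0 z ->
  {within `[0, +oo[, continuous (fun s => E (z s))}.
Proof.
move=> [_ cz _] t.
exact: (@continuous_comp _ _ _ (from_subspace _ z) E t (cz t) (@E_continuous (z t))).
Qed.

Let energy_nonincr H z0 z : (forall x, dot (x - zs) (P *m H x) <= 0) ->
  solution H z0 z -> forall s t, 0 <= s -> s <= t -> E (z t) <= E (z s).
Proof.
move=> Hle sol s t s0 st.
apply: (@is_derive_le0_nonincr _ (fun r => E (z r))
  (fun r => 2 * dot (z r - zs) (P *m H (z r)))) => // [|r /andP[sr _]|r _].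
- apply: continuous_subspaceW (energy_within sol).
  by apply: subset_itv; rewrite ?bnd_simp.
- exact: energy_derive sol (le_lt_trans s0 sr).
- by rewrite pmulr_rle0.
Qed.

Let stable : lyapunov_stable G zs.
Proof.
(* The energy lies between [p1] and [p2] times the squared distance and never increases; the square
   root converts between the two bounds. *)
move=> e e0; exists (e * Num.sqrt (p1 / p2)).
  by rewrite mulr_gt0 // sqrtr_gt0 divr_gt0.
move=> z0 z sol z0e t t0.
have := energy_nonincr dissipation_le0 sol (lexx 0) t0.
have [-> _ _] := sol => Et.
rewrite -(@ltr_pXn2r _ 2) ?nnegrE ?enorm_ge0 ?ltW // sqr_enorm.
have h : enorm (z0 - zs) ^+ 2 < e ^+ 2 * (p1 / p2).
  have -> : e ^+ 2 * (p1 / p2) = (e * Num.sqrt (p1 / p2)) ^+ 2.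
    by rewrite exprMn sqr_sqrtr // divr_ge0 // ltW.
  by rewrite ltr_pXn2r ?nnegrE ?enorm_ge0 ?mulr_ge0 ?sqrtr_ge0 ?ltW.
rewrite sqr_enorm mulrA ltr_pdivlMr // in h.
rewrite -(ltr_pM2l p1_gt0); apply: (le_lt_trans (P_lower _)).
apply: (le_lt_trans Et); apply: (le_lt_trans (P_upper _)).
by rewrite mulrC [ltRHS]mulrC.
Qed.

(* The cutoff makes the field bounded; since the energy of a solution never
   increases, the solution never sees the cutoff. *)
Let existence z0 : exists z, solution G z0 z.
Proof.
pose M := E z0 + 1.
have M0 : 0 < M by rewrite ltr_wpDl // V_ge0.
(* Equal to 1 where [E z <= M], to 0 where [E z >= 2 * M], and affine in [E z] between. *)
pose chi z := Num.min (Num.max (2 - E z / M) 0) 1.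
have chi0 z : 0 <= chi z by rewrite le_min ler01 le_max lexx orbT.
have chi1 z : chi z <= 1 by rewrite ge_min lexx orbT.
pose H z := chi z *: G z.
have chi_c : continuous chi.
  pose clamp (r : R) : R := Num.min (Num.max (2 - r / M) 0) 1.
  have clamp_c : continuous clamp.
    apply: (@lipschitz_continuous _ R^o R^o clamp M^-1) => r s.
    have mono (a b : R) : a <= b ->
        0 <= Num.min (Num.max b 0) 1 - Num.min (Num.max a 0) 1 <= b - a.
      move=> ab; case: (leP a 0) => ?; case: (leP b 0) => ?; case: (leP a 1) => ?;
        case: (leP b 1) => ?; rewrite ?(min_l ler01); apply/andP; split; lra.
    wlog rs : r s / s <= r.
      move=> wl; case: (leP s r) => [|/ltW] rs; first exact: wl.
      by rewrite distrC (distrC r); exact: wl.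
    have : 2 - r / M <= 2 - s / M by rewrite lerD2l lerN2 ler_pM2r ?invr_gt0.
    move=> /mono /andP[d0 d1]; rewrite distrC [leLHS]ger0_norm //.
    by rewrite (le_trans d1) // ger0_norm ?subr_ge0 // mulrBr; lra.
  by move=> z; exact: (continuous_comp (@E_continuous z) (@clamp_c (E z))).
have H_c : continuous H.
  by move=> z; exact: (continuousZ (chi_c z) (@scaled_continuous z)).
have [k k0 bounds] := field_bounds.
pose B := Num.sqrt (K / p1 * (2 * M)).
have H_bounded z : `|H z| <= sigma B * B.
  apply: (le_trans (mx_norm_le_enorm _)); rewrite enormZ ger0_norm //.
  have [EM|EM] := leP (2 * M) (E z).
    have -> : chi z = 0.
      rewrite /chi max_r ?min_l // subr_le0 ler_pdivlMr //.
    by rewrite mul0r mulr_ge0 ?sqrtr_ge0.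
  apply: (@le_trans _ _ (enorm (G z))); first by rewrite ler_piMl // enorm_ge0.
  (* On [E z < 2 * M] the norm of [F z] is at most [B], and the norm of the scaled field is monotone
     in it. *)
  rewrite enorm_scaled; apply: profileM_le => //; first exact: enorm_ge0.
  have [_ hi] := bounds z.
  rewrite -[leLHS]ger0_norm ?enorm_ge0 // -sqrtr_sqr ler_wsqrtr //.
  by rewrite (le_trans hi) // ler_pM2l ?divr_gt0 // ltW.
have Hle x : dot (x - zs) (P *m H x) <= 0.
  by rewrite -scalemxAr dotZr mulr_ge0_le0.
have [z sol] := peano z0 H_c H_bounded.
exists z; have [z00 cz dz] := sol; split=> // t t0.
have HG : H (z t) = G (z t).
  have Et : E (z t) <= E z0.
    by have := energy_nonincr Hle sol (lexx 0) (ltW t0); rewrite z00.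
  have EM : E (z t) / M <= 1 by rewrite ler_pdivrMr // mul1r (le_trans Et) // lerDl.
  have c1 : 1 <= 2 - E (z t) / M by move: EM; lra.
  by rewrite /H /chi max_l ?(le_trans ler01) // min_r // scale1r.
by rewrite -HG; exact: dz.
Qed.

(** On the shell the norm of [F] stays in [al, be] with al > 0, where [sigma] is Lipschitz. The
    difference of the fields splits into [sigma r] times [F a - F b], which contributes a
    nonpositive term by monotonicity, and a multiple of [F b], which the Lipschitz bound
    controls. *)
Let one_sided_lipschitz v M : 0 < v -> exists2 C, 0 <= C &
  forall a b, v <= E a <= M -> v <= E b <= M ->
    dot (a - b) (P *m (G a - G b)) <= C * V (a - b).
Proof.
move=> v0; have [k k0 bounds] := field_bounds.
have [CP CP0 hCP] := mulmx_dot_bounded P.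
pose al := Num.sqrt (v / (p2 * k)); pose be := Num.sqrt (K / p1 * M).
have al0 : 0 < al by rewrite sqrtr_gt0 divr_gt0 // mulr_gt0.
have [kl kl0 lip] := profile_lipschitz eta1_gt0 eta2_gt0 l1_gt0 l2_gt0 be al0.
have Nbound a : v <= E a <= M -> al <= enorm (F a) <= be.
  move=> /andP[va aM]; have [lo hi] := bounds a.
  rewrite -[enorm _]ger0_norm ?enorm_ge0 // -sqrtr_sqr !ler_wsqrtr //.
    by rewrite (le_trans hi) // ler_pM2l ?divr_gt0.
  by rewrite (le_trans _ lo) // ler_pM2r // invr_gt0 mulr_gt0.
pose C := kl * Num.sqrt K * (Num.sqrt CP * be).
have C0 : 0 <= C by rewrite !mulr_ge0 ?sqrtr_ge0.
exists (C / p1); first by rewrite divr_ge0 // ltW.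
move=> a b ha hb; have Na := Nbound a ha; have Nb := Nbound b hb.
rewrite !scaledE; set r := enorm (F a) in Na *; set s := enorm (F b) in Nb *.
have -> : sigma r *: F a - sigma s *: F b =
    sigma r *: (F a - F b) + (sigma r - sigma s) *: F b.
  by rewrite scalerBr scalerBl addrA subrK.
rewrite mulmxDr dotDr -!scalemxAr !dotZr.
have h1 : sigma r * dot (a - b) (P *m (F a - F b)) <= 0.
  rewrite mulr_ge0_le0 //; apply: (le_trans (F_mono a b)).
  by rewrite mulNr oppr_le0 mulr_ge0 ?dot_ge0 // ltW.
have h2 : (sigma r - sigma s) * dot (a - b) (P *m F b) <= C * dot (a - b) (a - b).
  apply: (le_trans (ler_norm _)); rewrite normrM.
  have n1 : `|sigma r - sigma s| <= kl * (Num.sqrt K * enorm (a - b)).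
    apply: (le_trans (lip _ _ Na Nb)); rewrite ler_wpM2l //.
    apply: (le_trans (enorm_dist _ _)).
    exact: enorm_le_sqrt (ltW K_gt0) (F_lip a b).
  have n2 : `|dot (a - b) (P *m F b)| <= enorm (a - b) * (Num.sqrt CP * be).
    apply: (le_trans (normr_dot_le _ _)); rewrite ler_wpM2l ?enorm_ge0 //.
    apply: (le_trans (enorm_le_sqrt (ltW CP0) (hCP (F b)))).
    by rewrite ler_wpM2l ?sqrtr_ge0 //; case/andP: Nb.
  apply: (le_trans (ler_pM _ _ n1 n2)) => //.
  by rewrite -sqr_enorm /C expr2; lra.
have h3 : C * dot (a - b) (a - b) <= C / p1 * V (a - b).
  by rewrite -mulrA ler_wpM2l // ler_pdivlMl.
lra.
Qed.

(** Energies decrease, so on [0, T] both solutions lie in the shell between the smaller of their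
    final energies and the initial one; Gronwall applies to [V (z s - w s)] there. *)
Let unique_before z0 z w T : 0 <= T -> solution G z0 z -> solution G z0 w ->
  z T != zs -> w T != zs -> z T = w T.
Proof.
move=> T0 solz solw; rewrite -!E_gt0 => zT wT.
pose v := Num.min (E (z T)) (E (w T)).
have v0 : 0 < v by rewrite lt_min zT wT.
have [C C0 lip] := one_sided_lipschitz (E z0) v0.
have zbound s : 0 <= s <= T -> v <= E (z s) <= E z0.
  move=> /andP[s0 sT].
  have := energy_nonincr dissipation_le0 solz s0 sT.
  have := energy_nonincr dissipation_le0 solz (lexx 0) s0.
  have [-> _ _] := solz => -> h; rewrite andbT (le_trans _ h) //.
  by rewrite ge_min lexx.
have wbound s : 0 <= s <= T -> v <= E (w s) <= E z0.
  move=> /andP[s0 sT].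
  have := energy_nonincr dissipation_le0 solw s0 sT.
  have := energy_nonincr dissipation_le0 solw (lexx 0) s0.
  have [-> _ _] := solw => -> h; rewrite andbT (le_trans _ h) //.
  by rewrite ge_min lexx orbT.
apply/eqP; rewrite -subr_eq0; apply/eqP; apply: V_eq0.
have [z00 cz dz] := solz; have [w00 cw dw] := solw.
suff -> : V (z T - w T) = 0 by [].
apply: (@gronwall_eq0 _ (fun s => V (z s - w s))
  (fun s => 2 * dot (z s - w s) (P *m (G (z s) - G (w s)))) (2 * C) T) => //.
- have sub : `[0, T] `<=` `[0 : R, +oo[ by apply: subset_itv; rewrite ?bnd_simp.
  move=> s; apply: (@continuous_comp _ _ _ (from_subspace `[0, T] (fun s => z s - w s)) V s).
    apply: continuousB.
      exact: (continuous_subspaceW sub cz).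
    exact: (continuous_subspaceW sub cw).
  exact: quad_continuous.
- move=> s /andP[s0 _]; apply: (@is_derive_quad _ _ P (fun s => z s - w s)) => // i.
  exact: is_derive_coordB (dz s s0) (dw s s0).
- move=> s /andP[s0 sT]; rewrite -mulrA ler_pM2l //.
  by apply: lip; [apply: zbound|apply: wbound]; rewrite !ltW.
- by rewrite z00 w00 subrr /V dot0l.
Qed.

(* If [z] has stopped at [zs] while [w] has not, pick by the intermediate value
   theorem a time where the energy of [z] is positive yet below that of [w]. *)
Let stop_together z0 z w t : 0 <= t -> solution G z0 z -> solution G z0 w ->
  z t = zs -> w t = zs.
Proof.
move=> t0 solz solw zt; apply/eqP; apply: contraT; rewrite -E_gt0 => wt.
have [z00 _ _] := solz; have [w00 _ _] := solw.
have E0 : E (w t) <= E z0.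
  by have := energy_nonincr dissipation_le0 solw (lexx 0) t0; rewrite w00.
have Ezt : E (z t) = 0 by rewrite zt /E subrr /V dot0l.
have [||s] := @IVT _ (fun s => E (z s)) 0 t (E (w t) / 2) t0.
- apply: continuous_subspaceW (energy_within solz).
  by apply: subset_itv; rewrite ?bnd_simp.
- rewrite Ezt z00 ge_min le_max; apply/andP; split; apply/orP.
    by right; rewrite divr_ge0 // V_ge0.
  by left; lra.
rewrite in_itv /= => /andP[s0 st] Es.
have zs_ : z s != zs by rewrite -E_gt0 Es divr_gt0.
have Ews := energy_nonincr dissipation_le0 solw s0 st.
have ws_ : w s != zs by rewrite -E_gt0 (lt_le_trans wt).
have := unique_before s0 solz solw zs_ ws_ => zw.
by move: Es Ews; rewrite zw; move: wt; lra.
Qed.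

Let uniqueness z0 z w : solution G z0 z -> solution G z0 w ->
  forall t, 0 <= t -> w t = z t.
Proof.
move=> solz solw t t0.
have [zt|zt] := eqVneq (z t) zs; first by rewrite zt (stop_together t0 solz solw).
have [wt|wt] := eqVneq (w t) zs; first by rewrite wt (stop_together t0 solw solz).
by rewrite (unique_before t0 solz solw).
Qed.

Theorem scaled_flow_fixed_time_stable : globally_fixed_time_stable G zs.
Proof.
have [Z solZ] := choice existence.
have [k1 [k2 [k10 k20 decay]]] := decay_rate.
pose Tmax := 1 + (l2 / 2 * k2)^-1 + (l1 / 2 * k1)^-1.
have half (x : R) : 0 < x -> 0 < x / 2 by move=> x0; rewrite divr_gt0.
have Tmax0 : 0 <= Tmax.
  by rewrite !addr_ge0 // invr_ge0 mulr_ge0 // ltW // half.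
have extinct z0 : Z z0 Tmax = zs.
  apply: E_eq0.
  apply: (@fixed_time_extinction _ (fun t => E (Z z0 t))
    (fun t => 2 * dot (Z z0 t - zs) (P *m G (Z z0 t))) k1 k2 (l1 / 2) (l2 / 2));
    rewrite ?half //.
  - by move=> t; exact: energy_derive (solZ z0).
  - by move=> t _; exact: V_ge0.
  - exact: energy_nonincr dissipation_le0 (solZ z0).
  - by move=> t _; exact: decay.
pose S z0 := [set t | 0 <= t /\ Z z0 t = zs].
(* The first hitting time. The set is nonempty because every solution is at rest at [Tmax], which
   does not depend on [z0]. *)
pose tau z0 := inf (S z0).
have S_T z0 : S z0 Tmax by split.
have S_lb z0 : lbound (S z0) 0 by move=> t [].
have S_inf z0 : has_inf (S z0) by split; [exists Tmax|exists 0].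
have tau0 z0 : 0 <= tau z0 by apply: lb_le_inf; [exists Tmax|exact: S_lb].
have tauT z0 : tau z0 <= Tmax by apply: ge_inf; [exists 0|].
have tau_cvg z0 : Z z0 t @[t --> within `[0, +oo[ (nbhs (tau z0))] --> Z z0 (tau z0).
  have [_ /subspace_continuousP cZ _] := solZ z0.
  by apply: cZ; rewrite /= in_itv /= tau0.
(* The infimum is attained: positive energy at [tau z0] would persist nearby by continuity, yet
   hitting times accumulate there. *)
have tau_zs z0 : Z z0 (tau z0) = zs.
  apply: E_eq0; apply/eqP; rewrite eq_le V_ge0 andbT leNgt; apply/negP => Etau.
  have /subspace_continuousP cE := energy_within (solZ z0).
  have {}cE : E (Z z0 t) @[t --> within `[0, +oo[ (nbhs (tau z0))] --> E (Z z0 (tau z0)).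
    by apply: cE; rewrite /= in_itv /= tau0.
  have near_tau := @cvgr_dist_lt _ _ _ _ _ _ _ cE _ Etau.
  have /nbhs_ballP[del /= del0 near_pos] : nbhs (tau z0) (fun t =>
      `[0, +oo[%classic t -> `|E (Z z0 (tau z0)) - E (Z z0 t)| < E (Z z0 (tau z0))).
    exact: near_tau.
  have [t [t0 Zt] ttau] := inf_adherent del0 (S_inf z0).
  have bt : ball (tau z0) del t.
    rewrite -ball_normE /ball_ /= distrC ger0_norm.
      by rewrite ltrBlDl.
    by rewrite subr_ge0 ge_inf //; exists 0.
  have tpos : `[0, +oo[%classic t by rewrite /= in_itv /= t0.
  have := near_pos t bt tpos; rewrite Zt.
  have -> : E zs = 0 by rewrite /E subrr /V dot0l.
  by rewrite subr0 gtr0_norm // ltxx.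
have settle : settling_time G zs tau.
  move=> z0; split => //; exists (Z z0); split=> //.
  - by move=> w solw t t0; exact: uniqueness (solZ z0) solw t t0.
  - by have := tau_cvg z0; rewrite tau_zs.
  - move=> t /andP[t0 ttau] Zt; move: ttau; rewrite ltNge => /negP; apply.
    by apply: ge_inf; [exists 0|].
split; first by split; [exact: stable|exists tau].
by exists tau => //; exists Tmax => _ [z0 _ <-].
Qed.

End strongly_monotone.

(** * Gradients and convexity *)

Section directional_derivatives.
Context {R : realType}.

(** The convexity and minimality inequalities bound the difference quotient on the required side
    only for t > 0. *)
Lemma is_derive_cvg_right (V : normedModType R) (f : V -> R) x v l :
  is_derive x v f l ->
  t^-1 * (f (t *: v + x) - f x) @[t --> 0^'+] --> l.
Proof.
move=> [df <-]; apply: cvg_trans df; apply: cvg_app => A [e e0 Ae].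
by exists e => // t te t0; apply: Ae => //; exact: lt0r_neq0.
Qed.

Lemma is_derive_ge0 (V : normedModType R) (f : V -> R) x v l :
  is_derive x v f l -> (forall y, f x <= f y) -> 0 <= l.
Proof.
move=> df fmin; have cv := is_derive_cvg_right df.
apply: (ler_cvg_to (cvg_cst 0) cv); near=> t.
have t0 : 0 < t by near: t; exact: nbhs_right_gt.
by rewrite mulr_ge0 ?subr_ge0 // invr_ge0 ltW.
Unshelve. all: by end_near. Qed.

(** This handles the piecewise penalty [hmu] without separating the points of its switching
    surface. *)
Lemma is_derive_quadratic_remainder (V : normedModType R) (f : V -> R) x v l C :
  (forall t, `|f (x + t *: v) - f x - t * l| <= C * t ^+ 2) -> is_derive x v f l.
Proof.
move=> rem.
suff cv : h^-1 *: ((f \o shift x) (h *: v) - f x) @[h --> 0^'] --> l.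
  by apply: DeriveDef; [exact: cvgP cv|exact: cvg_lim cv].
apply/cvgrPdist_le => e e0.
have C1 : 0 < `|C| + 1 by rewrite ltr_wpDl.
near=> h; have h0 : h != 0 by near: h; exact: nbhs_dnbhs_neq.
have hd : `|h| < e / (`|C| + 1) by near: h; apply: dnbhs0_lt; rewrite divr_gt0.
have hn : 0 < `|h| by rewrite normr_gt0.
have -> : l - h^-1 *: ((f \o shift x) (h *: v) - f x) =
    - (h^-1 * (f (x + h *: v) - f x - h * l)).
  by rewrite /= [h *: v + x]addrC mulrBr mulKf // opprB.
rewrite normrN normrM normfV ler_pdivrMl // (le_trans (rem h)) //.
rewrite -real_normK ?num_real // expr2 mulrCA ler_wpM2l //.
rewrite (le_trans (ler_wpM2r _ (ler_norm C))) //.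
rewrite ltr_pdivlMr // in hd; rewrite mulrC.
by apply: le_trans (ltW hd); rewrite ler_wpM2l // lerDl.
Unshelve. all: by end_near. Qed.

Lemma differentiable_is_derive n (f : 'cV[R]_n -> R) x v :
  differentiable f x -> is_derive x v f (dot (gradient f x) v).
Proof.
move=> df; apply: DeriveDef; first exact: diff_derivable.
rewrite deriveE // {1}(_ : v = \sum_i v i 0 *: delta_mx i 0); last first.
  apply/colP => i; rewrite summxE (bigD1 i) //= !mxE !eqxx mulr1 big1 ?addr0 //.
  by move=> j ji; rewrite !mxE eq_sym (negbTE ji) mulr0.
rewrite linear_sum dotE; apply: eq_bigr => i _.
by rewrite linearZ /= /gradient mxE deriveE // mulrC.
Qed.

Lemma gradient_is_derive n (f : 'cV[R]_n -> R) x g :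
  (forall v, is_derive x v f (dot g v)) -> gradient f x = g.
Proof.
move=> df; apply/colP => i; rewrite mxE (@derive_val _ _ _ _ _ _ _ (df _)).
rewrite dotE (bigD1 i) //= mxE !eqxx mulr1 big1 ?addr0 // => j ji.
by rewrite mxE (negbTE ji) mulr0.
Qed.

Lemma gradient_min n (f : 'cV[R]_n -> R) x g :
  (forall v, is_derive x v f (dot g v)) -> (forall y, f x <= f y) -> g = 0.
Proof.
move=> df fmin; apply/eqP; rewrite -dot_eq0 eq_le dot_ge0 andbT.
by have := is_derive_ge0 (df (- g)) fmin; rewrite dotNr oppr_ge0.
Qed.

(** The hypothesis at the point x + t (y - x), after division by [t], bounds the difference quotient
    by [q t]; then t tends to 0 from the right. *)
Lemma strongly_convex_gradient n (f : 'cV[R]_n -> R) m :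
  (forall x, differentiable f x) ->
  (forall (x y : 'cV[R]_n) (t : R), 0 <= t <= 1 ->
      f (t *: x + (1 - t) *: y) <=
        t * f x + (1 - t) * f y - m / 2 * t * (1 - t) * enorm (x - y) ^+ 2) ->
  forall x y, f x + dot (gradient f x) (y - x) + m / 2 * dot (y - x) (y - x) <= f y.
Proof.
move=> df fconv x y.
have cv := is_derive_cvg_right (differentiable_is_derive (y - x) (df x)).
pose q (t : R) := f y - f x - m / 2 * dot (y - x) (y - x) + t * (m / 2 * dot (y - x) (y - x)).
have qcv : q t @[t --> 0^'+] --> f y - f x - m / 2 * dot (y - x) (y - x).
  rewrite -[X in _ --> X]addr0 -[X in _ --> _ + X](mul0r (m / 2 * dot (y - x) (y - x))).
  apply: cvgD; first exact: cvg_cst.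
  by apply: cvgMr_tmp; exact: cvg_within.
suff : dot (gradient f x) (y - x) <= f y - f x - m / 2 * dot (y - x) (y - x) by lra.
apply: (ler_cvg_to cv qcv); near=> t.
have t0 : 0 < t by near: t; exact: nbhs_right_gt.
have t1 : t < 1 by near: t; exact: nbhs_right_lt.
rewrite ler_pdivrMl //.
have := fconv y x t; rewrite (ltW t0) (ltW t1) sqr_enorm => /(_ isT).
have -> : t *: y + (1 - t) *: x = t *: (y - x) + x.
  by apply/colP => i; rewrite !mxE; ring.
by rewrite /q; move: (dot (y - x) (y - x)) => D; lra.
Unshelve. all: by end_near. Qed.

End directional_derivatives.

(** * The generalized Lagrangian *)

Section proximal_penalty.
Context {R : realType}.
Implicit Types (mu v w t a b s : R).

(** Completing the square in the first branch merges the two cases into the usual augmented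
    Lagrangian term. *)
Lemma hmuE mu v w : 0 < mu ->
  hmu mu v w = (Num.max (mu * v + w) 0 ^+ 2 - w ^+ 2) / (2 * mu).
Proof.
move=> mu0; rewrite /hmu; case: (leP 0 (mu * v + w)) => h.
  by field; rewrite gt_eqF.
by field; rewrite gt_eqF.
Qed.

(** The square of the positive part is convex, whence the lower bound, and its derivative is
    2-Lipschitz, whence the upper one. *)
Lemma sqr_max_remainder a s :
  0 <= Num.max (a + s) 0 ^+ 2 - Num.max a 0 ^+ 2 - 2 * s * Num.max a 0 <= s ^+ 2.
Proof.
case: (leP a 0) => ?; case: (leP (a + s) 0) => ?; apply/andP; split; nra.
Qed.

(** The lower bound is convexity in [v], used for the saddle inequality; the upper bound yields the
    derivative. The next lemma does the same for concavity in [w]. *)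
Lemma hmu_remainder_left mu v w t : 0 < mu ->
  0 <= hmu mu (v + t) w - hmu mu v w - t * Num.max (mu * v + w) 0 <= mu / 2 * t ^+ 2.
Proof.
move=> mu0; rewrite !hmuE //.
have -> : mu * (v + t) + w = mu * v + w + mu * t by rewrite mulrDr addrAC.
have := sqr_max_remainder (mu * v + w) (mu * t).
move: (Num.max (mu * v + w + mu * t) 0) (Num.max (mu * v + w) 0) => p q /andP[h1 h2].
have -> : (p ^+ 2 - w ^+ 2) / (2 * mu) - (q ^+ 2 - w ^+ 2) / (2 * mu) - t * q =
    (p ^+ 2 - q ^+ 2 - 2 * (mu * t) * q) / (2 * mu) by field; rewrite gt_eqF.
have mu2 : 0 < 2 * mu by rewrite mulr_gt0.
rewrite divr_ge0 ?(ltW mu2) // ler_pdivrMr //.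
by rewrite (le_trans h2) // le_eqVlt; apply/orP; left; apply/eqP; field.
Qed.

Lemma hmu_remainder_right mu v w t : 0 < mu ->
  0 <= hmu mu v w + t * (mu^-1 * (Num.max (mu * v + w) 0 - w)) - hmu mu v (w + t)
    <= (2 * mu)^-1 * t ^+ 2.
Proof.
move=> mu0; rewrite !hmuE // addrA.
have := sqr_max_remainder (mu * v + w) t.
move: (Num.max (mu * v + w + t) 0) (Num.max (mu * v + w) 0) => p q /andP[h1 h2].
have -> : (q ^+ 2 - w ^+ 2) / (2 * mu) + t * (mu^-1 * (q - w)) -
    (p ^+ 2 - (w + t) ^+ 2) / (2 * mu) =
    (2 * mu)^-1 * (t ^+ 2 - (p ^+ 2 - q ^+ 2 - 2 * t * q)) by field; rewrite gt_eqF.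
have mu2 : 0 < (2 * mu)^-1 by rewrite invr_gt0 mulr_gt0.
rewrite mulr_ge0 ?subr_ge0 ?(ltW mu2) //= ler_pM2l //; lra.
Qed.

(** Writing p, q for the positive parts of a, b, complementarity p (p - a) = q (q - b) = 0 reduces
    the product to p (q - b) + q (p - a), a sum of nonnegative terms. *)
Lemma max0_firmly_nonexpansive a b :
  0 <= (Num.max a 0 - Num.max b 0) * ((a - b) - (Num.max a 0 - Num.max b 0)).
Proof.
have P (x : R) : [/\ 0 <= Num.max x 0, 0 <= Num.max x 0 - x &
    Num.max x 0 * (Num.max x 0 - x) = 0].
  by case: (leP x 0) => ?; split; rewrite ?subrr ?mulr0 ?mul0r //; lra.
have [p0 pa pp] := P a; have [q0 qb qq] := P b.
have := mulr_ge0 p0 qb; have := mulr_ge0 q0 pa; lra.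
Qed.

Lemma max0_nonexpansive a b : (Num.max a 0 - Num.max b 0) ^+ 2 <= (a - b) ^+ 2.
Proof.
have := max0_firmly_nonexpansive a b; move: (Num.max a 0 - Num.max b 0) => p.
by have := sqr_ge0 (a - b - p); rewrite !expr2; lra.
Qed.

End proximal_penalty.

Section lagrangian.
Context {R : realType} {n d : nat}.
Variables (f : 'cV[R]_n -> R) (A : 'M[R]_(d, n)) (b : 'cV[R]_d) (mu : R).
Hypothesis mu_gt0 : 0 < mu.
Hypothesis f_diff : forall x, differentiable f x.

Let L := gen_lagrangian f A b mu.

Definition multiplier (x : 'cV[R]_n) (y : 'cV[R]_d) : 'cV[R]_d :=
  \col_i Num.max (mu * residual A b x i + y i 0) 0.

Lemma residualE x i : residual A b x i = (A *m x) i 0 - b i 0.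
Proof. by rewrite /residual -row_mul mxE. Qed.

Lemma is_derive_lagrangian_primal x y v :
  is_derive x v (fun x => L x y) (dot (gradient f x + A^T *m multiplier x y) v).
Proof.
rewrite dotDl.
have -> : dot (A^T *m multiplier x y) v =
    \sum_i (A *m v) i 0 * Num.max (mu * residual A b x i + y i 0) 0.
  rewrite -dot_mulmx dotE; apply: eq_bigr => i _; by rewrite mxE mulrC.
have -> : (fun x => L x y) =
    f + \sum_(i < d) (fun x => hmu mu (residual A b x i) (y i 0)).
  by apply/funext => u; rewrite /L /gen_lagrangian fctE fct_sumE.
apply: is_deriveD; first exact: differentiable_is_derive.
apply: is_derive_sum => i.
apply: (@is_derive_quadratic_remainder _ _ _ _ _ _ (mu / 2 * (A *m v) i 0 ^+ 2)) => t.
have -> : residual A b (x + t *: v) i = residual A b x i + t * (A *m v) i 0.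
  by rewrite !residualE mulmxDr -scalemxAr !mxE addrAC.
have /andP[h1 h2] := hmu_remainder_left (residual A b x i) (y i 0)
  (t * (A *m v) i 0) mu_gt0.
rewrite mulrA ger0_norm // (le_trans h2) //.
by rewrite le_eqVlt; apply/orP; left; apply/eqP; ring.
Qed.

Lemma is_derive_lagrangian_dual x y v :
  is_derive y v (L x) (dot (mu^-1 *: (multiplier x y - y)) v).
Proof.
rewrite dotE.
have -> : L x = cst (f x) + \sum_(i < d) (fun y : 'cV[R]_d => hmu mu (residual A b x i) (y i 0)).
  by apply/funext => u; rewrite /L /gen_lagrangian fctE fct_sumE.
rewrite -[X in is_derive _ _ _ X]add0r; apply: is_deriveD.
apply: is_derive_sum => i.
apply: (@is_derive_quadratic_remainder _ _ _ _ _ _ ((2 * mu)^-1 * v i 0 ^+ 2)) => t.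
have /andP[h1 h2] := hmu_remainder_right (residual A b x i) (y i 0) (t * v i 0) mu_gt0.
rewrite !mxE -normrN ger0_norm; last first.
  by apply: le_trans h1 _; rewrite le_eqVlt; apply/orP; left; apply/eqP; ring.
rewrite -subr_ge0 in h2; rewrite -subr_ge0 (le_trans h2) //.
by rewrite le_eqVlt; apply/orP; left; apply/eqP; ring.
Qed.

Lemma saddle_field_col x y :
  saddle_field L (col_mx x y) =
    col_mx (- gradient f x - A^T *m multiplier x y) (mu^-1 *: (multiplier x y - y)).
Proof.
rewrite /saddle_field col_mxKu col_mxKd.
rewrite (gradient_is_derive (is_derive_lagrangian_primal x y)).
by rewrite (gradient_is_derive (is_derive_lagrangian_dual x y)) opprD.
Qed.

Lemma saddle_field_components x y :
  saddle_field L (col_mx x y) =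
       col_mx
         (- gradient f x
          - \sum_(i < d)
              Num.max (mu * residual A b x i + y i 0) 0 *: (row i A)^T)
         (mu^-1 *: \sum_(i < d)
              Num.max (mu * residual A b x i) (- y i 0) *: delta_mx i 0).
Proof.
rewrite saddle_field_col; congr (col_mx (_ - _) (_ *: _)).
  apply/colP => j; rewrite summxE mxE; apply: eq_bigr => i _.
  by rewrite !mxE mulrC.
apply/colP => j; rewrite summxE (bigD1 j) //= !mxE !eqxx mulr1 big1 ?addr0.
  by rewrite -[X in Num.max _ X](addNr (y j 0)) -addr_maxl; lra.
by move=> i ij; rewrite !mxE eq_sym (negbTE ij) mulr0.
Qed.

Lemma saddle_point_field z : saddle_point L z -> saddle_field L z = 0.
Proof.
rewrite -(vsubmxK z); move: (usubmx z) (dsubmx z) => x y {z} sad.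
rewrite /saddle_point col_mxKu col_mxKd in sad.
have gx := gradient_min (is_derive_lagrangian_primal x y) (fun u => (sad u y).2).
(* Maximality in [y] is minimality for the opposite function. *)
have gy : - (mu^-1 *: (multiplier x y - y)) = 0.
  apply: (@gradient_min _ _ (fun u => - L x u) y) => [v|u].
    by rewrite dotNl; apply: is_deriveN; exact: is_derive_lagrangian_dual.
  by rewrite lerN2; exact: (sad x u).1.
move/eqP: gy; rewrite oppr_eq0 => /eqP gy.
by rewrite saddle_field_col -opprD gx gy oppr0 col_mx0.
Qed.

(** Stationarity is enough: the lower remainder bounds place [L] below its tangent plane in [y] and,
    with the convexity of [f], above it in [x]. *)
Lemma field_saddle_point z :
  (forall x y, f x + dot (gradient f x) (y - x) <= f y) ->
  saddle_field L z = 0 -> saddle_point L z.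
Proof.
move=> fconv; rewrite -(vsubmxK z); move: (usubmx z) (dsubmx z) => x y {z}.
rewrite saddle_field_col -[X in _ = X]col_mx0 => /eq_col_mx[gx gy].
move/eqP: gx; rewrite -opprD oppr_eq0 => /eqP gx.
rewrite /saddle_point col_mxKu col_mxKd => u w; rewrite /L /gen_lagrangian; split.
  rewrite lerD2l -subr_ge0 -sumrB.
  apply: (@le_trans _ _ (dot (mu^-1 *: (multiplier x y - y)) (y - w))).
    by rewrite gy dot0l.
  rewrite dotE; apply: ler_sum => i _; rewrite !mxE.
  have /andP[h _] := hmu_remainder_right (residual A b x i) (y i 0) (w i 0 - y i 0) mu_gt0.
  by rewrite [y i 0 + _]addrC subrK in h; lra.
have fu := fconv x u.
have : \sum_(i < d) hmu mu (residual A b x i) (y i 0) +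
    dot (A^T *m multiplier x y) (u - x) <= \sum_(i < d) hmu mu (residual A b u i) (y i 0).
  rewrite -dot_mulmx dotE -big_split /=; apply: ler_sum => i _.
  have /andP[h _] := hmu_remainder_left (residual A b x i) (y i 0)
    ((A *m (u - x)) i 0) mu_gt0.
  have ru : residual A b u i = residual A b x i + (A *m (u - x)) i 0.
    by rewrite !residualE mulmxBr !mxE; ring.
  by rewrite ru [multiplier _ _ _ _]mxE; lra.
have := dot0l (u - x); rewrite -gx dotDl; lra.
Qed.

End lagrangian.

(** * Monotonicity and Lipschitz estimates for the saddle field *)

Section primal_dual_monotonicity.
Context {R : realType} {n d : nat}.
Implicit Types (A : 'M[R]_(d, n)) (a mu : R).

Definition lyapunov_mx A a : 'M[R]_(n + d) := block_mx a%:M A^T A a%:M.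

Lemma lyapunov_mx_sym A a : (lyapunov_mx A a)^T = lyapunov_mx A a.
Proof. by rewrite tr_block_mx !tr_scalar_mx trmxK. Qed.

Lemma lyapunov_mxE A a (x x' : 'cV[R]_n) (y y' : 'cV[R]_d) :
  dot (col_mx x y) (lyapunov_mx A a *m col_mx x' y') =
    a * dot x x' + dot (A *m x) y' + dot (A^T *m y) x' + a * dot y y'.
Proof.
rewrite /lyapunov_mx mul_block_col dot_col_mx !dotDr !mul_scalar_mx !dotZr.
by rewrite (dot_mulmx A^T x y') trmxK (dot_mulmx A y x'); ring.
Qed.

(** The off-diagonal blocks contribute 2 (A x).y, which is at most CA |x|^2 + |y|^2 in absolute
    value; Young's inequality with [y] and with [- y] gives both signs. *)
Lemma lyapunov_mx_bounds A a CA (z : 'cV[R]_(n + d)) : 0 <= CA ->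
  (forall x, dot (A *m x) (A *m x) <= CA * dot x x) ->
  (a - 1 - CA) * dot z z <= dot z (lyapunov_mx A a *m z) /\
  dot z (lyapunov_mx A a *m z) <= (a + 1 + CA) * dot z z.
Proof.
move=> CA0 hCA; rewrite -(vsubmxK z); move: (usubmx z) (dsubmx z) => x y.
rewrite lyapunov_mxE dot_col_mx.
have -> : dot (A^T *m y) x = dot (A *m x) y by rewrite -dot_mulmx dotC.
have h1 := @dot_AMGM _ _ 1 (A *m x) y ltr01.
have h2 := @dot_AMGM _ _ 1 (A *m x) (- y) ltr01.
rewrite !dotNr dotNl opprK in h2; rewrite invr1 !mul1r in h1 h2.
have h3 := hCA x; have x0 := dot_ge0 x; have y0 := dot_ge0 y.
have hx := mulr_ge0 CA0 x0; have hy := mulr_ge0 CA0 y0.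
by split; lra.
Qed.

(* Here [x, y, g, p] are the differences of the primal variables, of the dual
   variables, of the gradients and of the multipliers. When [p] is close to [y]
   the first-order damping of [y] disappears; the off-diagonal blocks of the
   Lyapunov matrix supply the missing term [- |A^T y|^2]. *)
Lemma primal_dual_dissipation A a mu m Lf CA CT CB c
    (x g : 'cV[R]_n) (y p : 'cV[R]_d) :
  0 < mu -> 0 < CB ->
  (forall x, dot (A *m x) (A *m x) <= CA * dot x x) ->
  (forall y, dot (A^T *m y) (A^T *m y) <= CT * dot y y) ->
  (forall y, dot y y <= CB * dot (A^T *m y) (A^T *m y)) ->
  m * dot x x <= dot x g -> dot g g <= Lf * dot x x ->
  0 <= dot p (mu *: (A *m x) + y - p) ->
  0 <= a -> c + Lf + CA / 2 <= a * m -> CT + mu^-1 ^+ 2 / 2 <= a / mu ->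
  0 <= c -> 2 * c * CB <= 1 ->
  dot (col_mx x y)
    (lyapunov_mx A a *m col_mx (- g - A^T *m p) (mu^-1 *: (p - y))) <=
  - c * dot (col_mx x y) (col_mx x y).
Proof.
move=> mu0 CB0 hCA hCT hCB hm hg hp a0 ha1 ha2 c0 hc.
rewrite lyapunov_mxE dot_col_mx.
pose e := p - y; have pE : p = e + y by rewrite /e subrK.
set w := A^T *m y; set v := A *m x.
have xAp : dot x (A^T *m p) = dot v p by rewrite dot_mulmx trmxK.
have wAp : dot w (A^T *m p) = dot w (A^T *m e) + dot w w.
  by rewrite pE mulmxDr dotDr.
rewrite !dotDr !dotNr !dotZr xAp wAp -/e.
have hx : a * (m * dot x x) <= a * dot x g by rewrite ler_wpM2l.
have hs : 0 <= a / mu * dot p (mu *: v + y - p) by rewrite mulr_ge0 // divr_ge0 // ltW.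
(* The diagonal blocks leave these two coupling terms; they combine into the firm nonexpansiveness
   term, of good sign, and the damping of [e]. *)
have main : - a * dot v p + a * (mu^-1 * dot y e) =
    - (a / mu * dot p (mu *: v + y - p)) - a / mu * dot e e.
  rewrite /e !dotDr !dotDl !dotNr !dotNl dotZr (dotC p v) (dotC p y).
  by field; rewrite gt_eqF.
(* Each of the two products with [w] costs a quarter of |w|^2, so half of the gain |w|^2 is left to
   dominate c |y|^2. The remainders produce the terms [Lf], [CT], [CA / 2] and [mu^-1 ^+ 2 / 2] of
   the conditions on [a]. *)
have h1 := @dot_AMGM _ _ (2^-1) w (- g) ltac:(by rewrite invr_gt0).
have h2 := @dot_AMGM _ _ (2^-1) w (- (A^T *m e)) ltac:(by rewrite invr_gt0).
have h3 := @dot_AMGM _ _ 1 v (mu^-1 *: e) ltr01.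
rewrite !dotNr !dotNl !opprK !invrK in h1 h2.
rewrite invr1 !mul1r dotZl !dotZr in h3.
have hv := hCA x; rewrite -/v in hv.
have he := hCT e; have hy := hCB y; rewrite -/w in hy.
have x0 := dot_ge0 x; have e0 := dot_ge0 e.
have k1 : (c + Lf + CA / 2) * dot x x <= a * m * dot x x by rewrite ler_wpM2r.
have k2 : (CT + mu^-1 ^+ 2 / 2) * dot e e <= a / mu * dot e e by rewrite ler_wpM2r.
have k3 : c * dot y y <= 2^-1 * dot w w.
  have w0 := dot_ge0 w.
  have : c * dot y y <= c * (CB * dot w w) by rewrite ler_wpM2l.
  have : 2 * c * CB * dot w w <= 1 * dot w w by rewrite ler_wpM2r.
  by lra.
move: main hs hx; rewrite !expr2 in k2 *.
move: (dot x g) (dot v p) (dot y e) (dot p _) (dot v e) (dot w g) (dot w (A^T *m e)) h1 h2 h3.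
move: k1 k2 k3 hv he hg.
by move: (dot x x) (dot e e) (dot w w) (dot y y) (dot v v) (dot g g) => *; lra.
Qed.

End primal_dual_monotonicity.

Lemma dotD_le (R : realType) n (u v : 'cV[R]_n) :
  dot (u + v) (u + v) <= 2 * dot u u + 2 * dot v v.
Proof.
have := dot_ge0 (u - v).
by rewrite !dotDl !dotDr !dotNl !dotNr (dotC v u); lra.
Qed.

(** Only |u + v|^2 <= 2 |u|^2 + 2 |v|^2 is iterated: the multiplier costs the factor
    [2 * mu ^+ 2 * CA + 2], and it enters the two blocks with weights [2 * CT] and
    [2 * mu^-1 ^+ 2]. *)
Lemma primal_dual_lipschitz (R : realType) n d (A : 'M[R]_(d, n)) mu Lf CA CT
    (x g : 'cV[R]_n) (y p : 'cV[R]_d) :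
  0 <= CT -> 0 <= CA ->
  (forall x, dot (A *m x) (A *m x) <= CA * dot x x) ->
  (forall y, dot (A^T *m y) (A^T *m y) <= CT * dot y y) ->
  dot g g <= Lf * dot x x -> 0 <= Lf ->
  dot p p <= dot (mu *: (A *m x) + y) (mu *: (A *m x) + y) ->
  dot (col_mx (- g - A^T *m p) (mu^-1 *: (p - y)))
      (col_mx (- g - A^T *m p) (mu^-1 *: (p - y))) <=
  (2 * Lf + (2 * CT + 2 * mu^-1 ^+ 2) * (2 * mu ^+ 2 * CA + 2) + 2 * mu^-1 ^+ 2)
    * dot (col_mx x y) (col_mx x y).
Proof.
move=> CT0 CA0 hCA hCT hg Lf0 hp; rewrite !dot_col_mx.
have x0 := dot_ge0 x; have y0 := dot_ge0 y.
have h1 := dotD_le (- g) (- (A^T *m p)).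
have h2 := dotD_le p (- y).
have h3 := dotD_le (mu *: (A *m x)) y.
rewrite !dotNr !dotNl !opprK in h1 h2; rewrite dotZl !dotZr in h3.
rewrite dotZl dotZr mulrA -expr2.
set q := mu^-1 ^+ 2; have q0 : 0 <= q by exact: sqr_ge0.
have h4 := hCT p.
have pp : dot p p <= (2 * mu ^+ 2 * CA + 2) * (dot x x + dot y y).
  have : mu ^+ 2 * dot (A *m x) (A *m x) <= mu ^+ 2 * (CA * dot x x).
    by rewrite ler_wpM2l ?sqr_ge0.
  have : 0 <= 2 * mu ^+ 2 * CA * dot y y.
    by rewrite mulr_ge0 // mulr_ge0 // mulr_ge0 // sqr_ge0.
  by rewrite expr2; lra.
have h5 : (2 * CT + 2 * q) * dot p p <=
    (2 * CT + 2 * q) * ((2 * mu ^+ 2 * CA + 2) * (dot x x + dot y y)).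
  by apply: ler_wpM2l => //; lra.
have h6 : q * dot (p - y) (p - y) <= q * (2 * dot p p + 2 * dot y y).
  by rewrite ler_wpM2l.
have h7 : 0 <= Lf * dot y y by rewrite mulr_ge0.
have h8 : 0 <= q * dot x x by rewrite mulr_ge0.
rewrite [leRHS]mulrDl [in leRHS]mulrDl -(mulrA (2 * CT + 2 * q)).
by move: h5; move: ((2 * mu ^+ 2 * CA + 2) * (dot x x + dot y y)) => W h5; lra.
Qed.

(** * Choice of the constants for the saddle field, and conclusion *)

Theorem corollary2 (R : realType) (n d : nat) (f : 'cV[R]_n -> R)
    (A : 'M[R]_(d, n)) (b : 'cV[R]_d) (mu eta1 eta2 lambda1 lambda2 : R)
    (f_sconvex : strongly_convex f) (f_smooth : lipschitz_gradient f)
    (A_full_row_rank : row_free A)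
    (mu_gt0 : 0 < mu) (eta1_gt0 : 0 < eta1) (eta2_gt0 : 0 < eta2)
    (lambda1_gt0 : 0 < lambda1) (lambda1_lt1 : lambda1 < 1)
    (lambda2_gt0 : 0 < lambda2) :
  let L := gen_lagrangian f A b mu in
  let F := saddle_field L in
  let G := fun z => time_scaling F eta1 eta2 lambda1 lambda2 z *: F z in
  (forall (x : 'cV[R]_n) (y : 'cV[R]_d),
     F (col_mx x y) =
       col_mx
         (- gradient f x
          - \sum_(i < d)
              Num.max (mu * residual A b x i + y i 0) 0 *: (row i A)^T)
         (mu^-1 *: \sum_(i < d)
              Num.max (mu * residual A b x i) (- y i 0) *: delta_mx i 0)) /\
  exists zs : 'cV[R]_(n + d),
    [/\ saddle_point L zs,
        forall z, saddle_point L z -> z = zs,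
        equilibrium G zs &
        globally_fixed_time_stable G zs].
Proof.
have [m m0 fconv] := f_sconvex; have [fdiff [Lf fLip]] := f_smooth.
move=> L F G; split; first by move=> x y; exact: saddle_field_components.
have [CA CA0 hCA] := mulmx_dot_bounded A.
have [CT CT0 hCT] := mulmx_dot_bounded A^T.
(* Full row rank enters here: a right inverse [B] of [A] recovers [y] as B^T (A^T y), so |A^T y|
   controls |y|. *)
have [B AB] := row_freeP A_full_row_rank.
have [CB CB0 hCB] := mulmx_dot_bounded B^T.
have {}hCB y : dot y y <= CB * dot (A^T *m y) (A^T *m y).
  by have := hCB (A^T *m y); rewrite mulmxA -trmx_mul AB trmx1 mul1mx.
have grad_conv := strongly_convex_gradient fdiff fconv.
have grad_conv0 x y : f x + dot (gradient f x) (y - x) <= f y.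
  have := grad_conv x y.
  have : 0 <= m / 2 * dot (y - x) (y - x) by rewrite mulr_ge0 ?dot_ge0 // divr_ge0 // ltW.
  by lra.
have grad_mono x x' :
    m * dot (x - x') (x - x') <= dot (x - x') (gradient f x - gradient f x').
  have := grad_conv x x'; have := grad_conv x' x; rewrite -(opprB x x').
  move: (x - x') => u; rewrite !dotNr dotNl opprK dotDr dotNr !(dotC u (gradient f _)).
  by lra.
have grad_lip x x' : dot (gradient f x - gradient f x') (gradient f x - gradient f x') <=
    Lf ^+ 2 * dot (x - x') (x - x').
  (* No sign of [Lf] is given; what gets squared is [Lf * enorm (x - x')], nonnegative because it
     bounds a norm. *)
  have h := fLip x x'; rewrite -!sqr_enorm -exprMn ler_pXn2r // nnegrE ?enorm_ge0 //.
  exact: le_trans (enorm_ge0 _) h.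
pose p (z : 'cV[R]_(n + d)) := multiplier A b mu (usubmx z) (dsubmx z).
have FE z : F z = col_mx (- gradient f (usubmx z) - A^T *m p z) (mu^-1 *: (p z - dsubmx z)).
  by rewrite -{1}(vsubmxK z); exact: saddle_field_col.
have dF z w : F z - F w = col_mx
    (- (gradient f (usubmx z) - gradient f (usubmx w)) - A^T *m (p z - p w))
    (mu^-1 *: (p z - p w - (dsubmx z - dsubmx w))).
  rewrite !FE opp_col_mx add_col_mx mulmxBr -scalerBr; congr (col_mx _ (_ *: _));
    by apply/colP => i; rewrite !mxE; ring.
have dz z w : z - w = col_mx (usubmx z - usubmx w) (dsubmx z - dsubmx w) :> 'cV_(n + d).
  by rewrite -{1}(vsubmxK z) -{1}(vsubmxK w) opp_col_mx add_col_mx.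
(* Coordinatewise the multipliers are positive parts of numbers differing by the displayed affine
   increment, so the scalar lemmas apply. *)
have p_diff z w i : exists r r' : R,
    [/\ p z i 0 - p w i 0 = Num.max r 0 - Num.max r' 0 &
    (mu *: (A *m (usubmx z - usubmx w)) + (dsubmx z - dsubmx w)) i 0 = r - r'].
  exists (mu * residual A b (usubmx z) i + dsubmx z i 0).
  exists (mu * residual A b (usubmx w) i + dsubmx w i 0).
  split; first by rewrite /p /multiplier !mxE.
  by rewrite !residualE mulmxBr !mxE; ring.
have p_firm z w : 0 <= dot (p z - p w)
    (mu *: (A *m (usubmx z - usubmx w)) + (dsubmx z - dsubmx w) - (p z - p w)).
  rewrite dotE; apply: sumr_ge0 => i _; have [r [r' [pE sE]]] := p_diff z w i.
  have E (u v : 'cV[R]_d) : (u - v) i 0 = u i 0 - v i 0 by rewrite !mxE.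
  by rewrite !E -E sE E pE max0_firmly_nonexpansive.
have p_nexp z w : dot (p z - p w) (p z - p w) <=
    dot (mu *: (A *m (usubmx z - usubmx w)) + (dsubmx z - dsubmx w))
        (mu *: (A *m (usubmx z - usubmx w)) + (dsubmx z - dsubmx w)).
  rewrite !dotE; apply: ler_sum => i _; have [r [r' [pE sE]]] := p_diff z w i.
  by rewrite sE -!expr2 [(p z - p w) i 0]mxE [(- p w) i 0]mxE pE max0_nonexpansive.
(* Chosen so that [2 * c * CB <= 1]. *)
pose c := (2 * CB + 1)^-1.
have CB1 : 0 < 2 * CB + 1 by rewrite addr_gt0 // mulr_gt0.
have c0 : 0 < c by rewrite invr_gt0.
pose a1 := (c + Lf ^+ 2 + CA / 2) / m; pose a2 := mu * (CT + mu^-1 ^+ 2 / 2).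
(* [a1] meets the condition on the primal terms, [a2] the one on [p - y], and [2 + CA] makes the
   lower bound [a - 1 - CA] of the metric positive. *)
pose a := a1 + a2 + (2 + CA).
have a10 : 0 <= a1.
  by rewrite divr_ge0 ?addr_ge0 ?sqr_ge0 ?divr_ge0 // ltW.
have a20 : 0 <= a2.
  rewrite /a2; have := sqr_ge0 mu^-1; move: (mu^-1 ^+ 2) => q q0.
  by apply: mulr_ge0; [exact: ltW|lra].
have a0 : 0 <= a by rewrite /a; lra.
have ha1 : c + Lf ^+ 2 + CA / 2 <= a * m.
  by rewrite -ler_pdivrMr // -/a1 /a; lra.
have ha2 : CT + mu^-1 ^+ 2 / 2 <= a / mu.
  by rewrite ler_pdivlMr // mulrC -/a2 /a; lra.
have hc : 2 * c * CB <= 1.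
  by rewrite mulrAC /c ler_pdivrMr // mul1r; lra.
pose K := 2 * Lf ^+ 2 + (2 * CT + 2 * mu^-1 ^+ 2) * (2 * mu ^+ 2 * CA + 2) + 2 * mu^-1 ^+ 2.
have mui : 0 < mu^-1 ^+ 2 by rewrite exprn_gt0 // invr_gt0.
have K0 : 0 < K.
  have X0 : 0 <= 2 * CT + 2 * mu^-1 ^+ 2 by lra.
  have Y0 : 0 <= 2 * mu ^+ 2 * CA + 2 by have := mulr_ge0 (sqr_ge0 mu) (ltW CA0); lra.
  apply: ltr_wpDl; last by rewrite mulr_gt0.
  by apply: addr_ge0; [rewrite mulr_ge0 ?sqr_ge0|exact: mulr_ge0].
have F_mono z w : dot (z - w) (lyapunov_mx A a *m (F z - F w)) <= - c * dot (z - w) (z - w).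
  rewrite dF dz; apply: (primal_dual_dissipation mu_gt0 CB0 hCA hCT hCB
    (grad_mono _ _) (grad_lip _ _) (p_firm z w) a0 ha1 ha2 (ltW c0) hc).
have F_lip z w : dot (F z - F w) (F z - F w) <= K * dot (z - w) (z - w).
  rewrite dF dz; exact: (primal_dual_lipschitz (ltW CT0) (ltW CA0) hCA hCT
    (grad_lip _ _) (sqr_ge0 _) (p_nexp z w)).
have p10 : 0 < a - 1 - CA by rewrite /a; lra.
have p20 : 0 < a + 1 + CA by rewrite /a; lra.
have P_lower z : (a - 1 - CA) * dot z z <= dot z (lyapunov_mx A a *m z).
  by have [] := lyapunov_mx_bounds a z (ltW CA0) hCA.
have P_upper z : dot z (lyapunov_mx A a *m z) <= (a + 1 + CA) * dot z z.
  by have [] := lyapunov_mx_bounds a z (ltW CA0) hCA.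
have P_sym := lyapunov_mx_sym A a.
have [zs Fzs] := monotone_zero p10 p20 c0 K0 P_sym P_lower P_upper F_mono F_lip.
have [k k0 inv_lip] := monotone_inverse_lipschitz c0 F_mono.
exists zs; split.
- exact: field_saddle_point.
- move=> z /(saddle_point_field mu_gt0 fdiff) Fz; apply/eqP; rewrite -subr_eq0 -dot_eq0.
  rewrite eq_le dot_ge0 andbT; have := inv_lip z zs.
  by rewrite [F z]Fz Fzs subrr dot0r mulr0.
- by rewrite /equilibrium /G Fzs scaler0.
exact: (scaled_flow_fixed_time_stable p10 p20 c0 K0 P_sym P_lower P_upper F_mono F_lip
  Fzs eta1_gt0 eta2_gt0 lambda1_gt0 lambda1_lt1 lambda2_gt0).
Qed.
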